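(* Let $\mathcal{M}$ be a finite polycube translation $3$-manifold and let $\mathbf{v}=(\alpha_1,\alpha_2,1)$ be a Kronecker direction, i.e. $\alpha_1,\alpha_2,1$ are linearly independent over $\mathbb{Q}$. Then every non-empty open set $G\subset\mathcal{M}$ has positive visiting frequency relative to geodesic segments in direction $\mathbf{v}$; that is, there exist constants $\mathfrak{F}>0$ and $c>0$ (depending on $G$, $\mathcal{M}$ and $\mathbf{v}$) such that every geodesic segment $L$ in $\mathcal{M}$ with direction $\mathbf{v}$ and length $|L|\ge c$ satisfies $\lambda_1(G\cap L)\ge\mathfrak{F}|L|$, where $\lambda_1$ denotes $1$-dimensional Lebesgue measure.
   Context: A finite polycube region $M$ is a connected (not necessarily simply-connected) polyhedron in $\mathbb{R}^3$ tiled by finitely many closed unit cubes (atomic cubes), such that any two atomic cubes are disjoint, or meet at a single point, or share an edge, or share a face, and any two atomic cubes are joined by a chain of atomic cubes in which consecutive cubes share a face. A finite polycube translation $3$-manifold $\mathcal{M}$ is obtained from $M$ by identifying in pairs, by translation, the boundary faces with inward normals in opposite directions. Geodesics are straight lines in a fixed direction continued across identified faces; a geodesic segment is a finite piece of such a geodesic. *)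

(* Defs.v *)
From HB Require Import structures.
From mathcomp Require Import all_boot all_order all_algebra.
From mathcomp Require Import all_classical all_reals all_analysis.
Set Implicit Arguments. Unset Strict Implicit. Unset Printing Implicit Defensive.
Import Order.TTheory GRing.Theory Num.Theory.
Local Open Scope ring_scope.

(** Atomic cubes: [c] denotes the closed unit cube  prod_j [c j, c j + 1]. *)
Definition cell := {ffun 'I_3 -> int}.

Definition shift (c : cell) (i : 'I_3) (k : int) : cell :=
  [ffun j => if j == i then c j + k else c j].

Definition face_adjb (c d : cell) : bool :=
  [exists i : 'I_3, (d == shift c i 1) || (d == shift c i (-1))].

(** A finite polycube region: a nonempty finite list of atomic cubes, any two of
    which are joined by a chain of cubes of the region, consecutive ones
    sharing a face.  (Distinct lattice cubes automatically meet in a face, an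
    edge, a point or not at all.) *)
Definition polycube_region (M : seq cell) : Prop :=
  M != [::] /\
  forall c d, c \in M -> d \in M ->
    exists s : seq cell, all (fun x => x \in M) s && path face_adjb c s
                         && (last c s == d).

(** Unit square faces of atomic cubes: the face of cube [fcell] orthogonal to
    axis [faxis], on the side x_i = c_i (fhigh = false, inward normal +e_i)
    or x_i = c_i + 1 (fhigh = true, inward normal -e_i). *)
Record face := Face { fcell : cell; faxis : 'I_3; fhigh : bool }.

Definition neighbor (F : face) : cell :=
  shift (fcell F) (faxis F) (if fhigh F then 1 else -1).

Definition boundary_face (M : seq cell) (F : face) : Prop :=
  fcell F \in M /\ neighbor F \notin M.

(** A pairing of the boundary faces: an involution on boundary faces
    matching each face with a face of inward normal in the opposite
    direction; the identification is by the translation carrying one face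
    onto the other. *)
Definition face_pairing (M : seq cell) (sigma : face -> face) : Prop :=
  forall F, boundary_face M F ->
    [/\ boundary_face M (sigma F), faxis (sigma F) = faxis F,
        fhigh (sigma F) = ~~ fhigh F & sigma (sigma F) = F].

Section Geometry.
Variable R : realType.

Definition pt := 'I_3 -> R.

Definition inM (M : seq cell) (x : pt) : Prop :=
  exists2 c, c \in M & forall j, (c j)%:~R <= x j <= (c j)%:~R + 1.

Definition fcorner (F : face) : pt :=
  fun j => ((fcell F j)%:~R + (if (j == faxis F) && fhigh F then 1 else 0)).

Definition in_face (F : face) (x : pt) : Prop :=
  x (faxis F) = fcorner F (faxis F) /\
  forall j, j != faxis F -> fcorner F j <= x j <= fcorner F j + 1.

Definition ftrans (sigma : face -> face) (F : face) : pt :=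
  fun j => fcorner (sigma F) j - fcorner F j.

Definition padd (x y : pt) : pt := fun j => x j + y j.
Definition pmove (x : pt) (t : R) (u : pt) : pt := fun j => x j + t * u j.

(** open subsets of the manifold, represented by their (saturated,
    relatively open) preimages in the polyhedron M  (quotient topology) *)
Definition manifold_open (M : seq cell) (sigma : face -> face) (G : set pt) :
    Prop :=
  [/\ forall x, G x -> inM M x,
      forall x, G x -> exists2 e : R, 0 < e &
          forall y, inM M y -> (forall j, `|y j - x j| < e) -> G y &
      forall F, boundary_face M F -> forall x, in_face F x ->
          (G x <-> G (padd x (ftrans sigma F)))].

Definition kronecker (a1 a2 : R) : Prop :=
  forall q1 q2 q3 : rat, ratr q1 * a1 + ratr q2 * a2 + ratr q3 = 0 ->
    [/\ q1 = 0, q2 = 0 & q3 = 0].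

Definition dirv (a1 a2 : R) : pt :=
  fun j => if j == 0 :> nat then a1 else if j == 1 :> nat then a2 else 1.

(** unit vector in direction v, so that the parameter is arclength *)
Definition unitdir (v : pt) : pt :=
  fun j => v j / Num.sqrt (v 0 ^+ 2 + v 1 ^+ 2 + v 2 ^+ 2).

(** A geodesic segment in direction v: a nonempty list of straight pieces
    (p_k, s_k), the k-th being  t |-> p_k + t u, t in [0, s_k]  (u the unit
    vector along v), each lying in the polyhedron M; each non-final piece ends
    at a point q of a boundary face F through which the line leaves M (u points
    against the inward normal and the line is immediately outside M after q),
    and the next piece starts at the identified point q + tau_F. *)
Fixpoint chain_ok (M : seq cell) (sigma : face -> face) (u : pt)
    (L : seq (pt * R)) : Prop :=
  match L with
  | [::] => True
  | [:: (p, s)] => 0 <= s /\ forall t, 0 <= t <= s -> inM M (pmove p t u)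
  | (p, s) :: (((p', _) :: _) as L') =>
      [/\ 0 <= s, (forall t, 0 <= t <= s -> inM M (pmove p t u)),
          exists F, [/\ boundary_face M F, in_face F (pmove p s u),
                        (if fhigh F then 0 < u (faxis F) else u (faxis F) < 0),
                        (exists2 e : R, 0 < e & forall t, 0 < t < e ->
                            ~ inM M (pmove p (s + t) u)) &
                        p' = padd (pmove p s u) (ftrans sigma F)]
        & chain_ok M sigma u L']
  end.

Definition geodesic_segment (M : seq cell) (sigma : face -> face) (v : pt)
    (L : seq (pt * R)) : Prop :=
  L != [::] /\ chain_ok M sigma (unitdir v) L.

Definition seg_length (L : seq (pt * R)) : R := \sum_(ps <- L) ps.2.

Definition visit_set (G : set pt) (v : pt) (ps : pt * R) : set R :=
  [set t : R | 0 <= t <= ps.2 /\ G (pmove ps.1 t (unitdir v))].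

Definition visit_measure (G : set pt) (v : pt) (L : seq (pt * R)) : \bar R :=
  (\sum_(ps <- L) lebesgue_measure (visit_set G v ps))%E.

End Geometry.

(* Main.v *)
(** Reduce the position modulo Z^3: the manifold becomes a finite cover of the torus,
    branched along lattice edges, whose sheets are the cubes, and crossing a wall
    permutes the sheets. A line in a Kronecker direction meets at most one edge of each
    of the three directions, so all but three of the blocks of a long segment are
    nonsingular, and it suffices that every nonsingular segment of some fixed length
    visits a given box inside G. Otherwise let K be the set of limits of states whose
    orbits avoid the box for longer and longer times. K is closed, flow invariant and
    nonempty over every torus point. The number of sheets of K is upper semicontinuous
    and monotone along orbits; as half-orbits are dense in the torus, this number is
    minimal, and the sheets of K are locally constant, at each point having a nonsingular
    forward or backward half-orbit. The other points lie on lines through two edges of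
    different directions; there are countably many such lines, and they do not
    disconnect a cube. Hence K consists of whole cubes; being invariant under crossing
    faces, it is everything, which contradicts that it avoids the box. *)
Require Import Defs.
From HB Require Import structures.
From mathcomp Require Import all_boot all_order all_algebra.
From mathcomp Require Import all_classical all_reals all_analysis.
From mathcomp Require Import zify ring lra.
Set Implicit Arguments. Unset Strict Implicit. Unset Printing Implicit Defensive.
Import Order.TTheory GRing.Theory Num.Theory.
Local Open Scope classical_set_scope.
Local Open Scope ring_scope.

(** * Finite uniformity, connectedness of an interval and discrete subgroups of the line *)

Lemma seq_uniform_bound (T : eqType) (s : seq T) (P : T -> nat -> Prop) :
  (forall x m n, (m <= n)%N -> P x m -> P x n) ->
  (forall x, x \in s -> exists n, P x n) ->
  exists n, forall x, x \in s -> P x n.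
Proof.
move=> mono; elim: s => [|x s IH] H; first by exists 0%N.
have [n1 h1] := H x (mem_head _ _).
have [|n2 h2] := IH; first by move=> y ys; apply: H; rewrite inE ys orbT.
exists (maxn n1 n2) => y; rewrite inE => /orP[/eqP->|/h2].
  by apply: mono h1; rewrite leq_maxl.
by apply: mono; rewrite leq_maxr.
Qed.

Lemma ord3P (j : 'I_3) : [\/ j = 0, j = 1 | j = 2].
Proof.
case: j => [[|[|[|//]]] h]; [constructor 1|constructor 2|constructor 3]; exact/val_inj.
Qed.

Lemma ord3_third (a i j l : 'I_3) : i != j -> l != i -> l != j ->
  [\/ a = i, a = j | a = l].
Proof.
rewrite -!val_eqE /= => ij li lj.
have [h|[h|h]] : a = i :> nat \/ (a = j :> nat \/ a = l :> nat).
  by move: (ltn_ord a) (ltn_ord i) (ltn_ord j) (ltn_ord l); lia.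
- by constructor 1; apply: val_inj.
- by constructor 2; apply: val_inj.
- by constructor 3; apply: val_inj.
Qed.

Section RealLine.
Variable R : realType.
Implicit Types x y e : R.

Lemma invn_lt e : 0 < e -> exists n : nat, n.+1%:R^-1 < e.
Proof.
move=> e0; exists (Num.trunc e^-1).
rewrite invf_plt ?posrE //.
by have := truncnS_gt e^-1.
Qed.

Lemma invSn_gt0 (n : nat) : 0 < n.+1%:R^-1 :> R.
Proof. by rewrite invr_gt0 ltr0n. Qed.

Lemma nat_ge x : exists n : nat, x <= n%:R.
Proof.
exists (Num.trunc x).+1; exact/ltW/truncnS_gt.
Qed.

(** Connectedness of the unit interval. It serves twice: to build itineraries along a line, and to
    propagate sheets inside a cube. *)
Lemma locally_constant_segment (P : R -> Prop) :
  (forall x, 0 <= x <= 1 -> exists2 d : R, 0 < d &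
     forall y, 0 <= y <= 1 -> `|y - x| < d -> (P y <-> P x)) ->
  P 0 -> P 1.
Proof.
move=> loc P0; apply: contrapT => nP1.
pose S := [set x : R | 0 <= x <= 1 /\ P x].
have hS : has_sup S.
  by split; [exists 0; split=> //; lra | exists 1 => x /= [+ _]; lra].
have s0 : 0 <= sup S by apply: (ub_le_sup hS.2); split => //; lra.
have s1 : sup S <= 1 by apply: (ge_sup hS.1) => x /= [+ _]; lra.
(* a point of S near the supremum forces P at the supremum and beyond, up to 1 *)
have [d d0 hd] := loc _ (introT andP (conj s0 s1)).
have [x [x01 Px] xs] := sup_adherent d0 hS.
have xle : x <= sup S by apply: (ub_le_sup hS.2).
have Ps : P (sup S) by apply/(hd x) => //; rewrite distrC ger0_norm; lra.
have s1' : sup S != 1 by apply: contra_notN nP1 => /eqP <-.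
have slt : sup S < 1 by rewrite lt_neqAle s1' s1.
pose y := Order.min 1 (sup S + d / 2).
have [y1 y2] : y <= 1 /\ y <= sup S + d / 2.
  by rewrite /y; split; rewrite ge_min lexx ?orbT.
have y3 : sup S < y by rewrite /y lt_min; apply/andP; split; lra.
have Py : P y by apply/(hd y) => //; [lra|rewrite ger0_norm; lra].
have : y <= sup S by apply: (ub_le_sup hS.2); split=> //; lra.
lra.
Qed.

(** Euclid's algorithm: if a positive [g] does not generate [H], some remainder modulo [g] is a
    smaller positive element of [H]. The drop is itself a positive element of [H], hence at least
    [eta], so the descent is finite. *)
Lemma discrete_subgroup_cyclic (H : R -> Prop) (eta h0 : R) :
  (forall x y, H x -> H y -> H (x - y)) -> 0 < eta ->
  (forall x, H x -> `|x| < eta -> x = 0) -> H h0 -> h0 != 0 ->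
  exists c, forall x, H x -> exists m : int, x = c * m%:~R.
Proof.
move=> sub eta0 disc Hh0 h00.
have H0 : H 0 by rewrite -(subrr h0); apply: sub.
have HN x : H x -> H (- x) by rewrite -sub0r; apply: sub.
have HM x (m : int) : H x -> H (x * m%:~R).
  move=> Hx; have Hn (n : nat) : H (x * n%:R).
    elim: n => [|n IH]; first by rewrite mulr0.
    have -> : x * n.+1%:R = x * n%:R - (- x) by rewrite -natr1; ring.
    exact: sub IH (HN _ Hx).
  case: m => n; first exact: Hn.
  rewrite NegzE mulrNz mulrN; exact/HN/Hn.
have main (N : nat) (g : R) : H g -> 0 < g -> g < N%:R * eta ->
    exists c, forall x, H x -> exists m : int, x = c * m%:~R.
  elim: N g => [|N IH] g Hg g0 gN; first by move: gN; rewrite mul0r; lra.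
  have [al|nal] := pselect (forall x, H x -> exists m : int, x = g * m%:~R).
    by exists g.
  move/existsNP: nal => [x /not_implyP[Hx /forallNP nx]].
  have := nx (Num.floor (x / g)); set m := Num.floor _ => nxm.
  have := floor_itv (x / g); rewrite -/m ler_pdivlMr // ltr_pdivrMr //.
  rewrite intrD mulrDl [m%:~R * g]mulrC mul1r => /andP[f1 f2].
  pose g' := x - g * m%:~R.
  have Hg' : H g' by apply: sub => //; apply: HM.
  have g'0 : 0 < g' by rewrite lt_neqAle subr_ge0 f1 andbT eq_sym subr_eq0; apply/eqP.
  have g'g : g' < g by rewrite /g'; lra.
  apply: (IH g') => //.
  have : eta <= g - g'.
    rewrite leNgt; apply/negP => lt; have := disc _ (sub _ _ Hg Hg').
    by rewrite ger0_norm; [move/(_ lt); lra|lra].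
  move: gN; rewrite -natr1; lra.
have ex g : H g -> 0 < g -> exists c, forall x, H x -> exists m : int, x = c * m%:~R.
  move=> Hg g0; have [N hN] := nat_ge (g / eta).
  apply: (main N.+1 g) => //; move: hN; rewrite ler_pdivrMr // -natr1; nra.
case: (ltgtP h0 0) h00 => // h _; last exact: (ex h0).
by apply: (ex (- h0)); [exact: HN|lra].
Qed.

Definition fpart x : R := x - (Num.floor x)%:~R.

Lemma fpart_itv x : 0 <= fpart x < 1.
Proof. by have := floor_itv x; rewrite intrD /fpart; lra. Qed.

(** Since [fpart x < 1], the truncation is at most [k] and [inord] never takes its default value. *)
Definition grid_index (k : nat) x : 'I_k.+1 := inord (Num.trunc (k.+1%:R * fpart x)).

Lemma grid_indexP k x :
  (grid_index k x)%:R <= k.+1%:R * fpart x < (grid_index k x)%:R + 1.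
Proof.
have K0 : 0 < k.+1%:R :> R by rewrite ltr0n.
have [f0 f1] := andP (fpart_itv x).
have g0 : 0 <= k.+1%:R * fpart x by rewrite mulr_ge0 // ltW.
have := truncn_itv g0; rewrite /grid_index inordK //; first by rewrite natr1.
by rewrite truncn_lt_nat // -[ltRHS]mulr1 ltr_pM2l.
Qed.

End RealLine.

(** * Kronecker's theorem in the plane *)

Section Kronecker.
Variables (R : realType) (a1 a2 : R).
Hypothesis kro : kronecker a1 a2.

Lemma kronecker_int (p q r : int) :
  p%:~R * a1 + q%:~R * a2 + r%:~R = 0 -> [/\ p = 0, q = 0 & r = 0].
Proof.
move=> h; have [] := kro (q1 := p%:~R) (q2 := q%:~R) (q3 := r%:~R); first by rewrite !ratr_int.
by move=> /eqP + /eqP + /eqP; rewrite !intr_eq0 => /eqP-> /eqP-> /eqP->.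
Qed.

(** The subgroup of the plane generated by the integer vectors and [(a1, a2)]. *)
Definition rot_group (x y : R) : Prop :=
  exists n p q : int, x = n%:~R * a1 + p%:~R /\ y = n%:~R * a2 + q%:~R.

Lemma rot_group_sub x y x' y' :
  rot_group x y -> rot_group x' y' -> rot_group (x - x') (y - y').
Proof.
move=> [n [p [q [-> ->]]]] [n' [p' [q' [-> ->]]]].
by exists (n - n'), (p - p'), (q - q'); rewrite !intrB; split; ring.
Qed.

Lemma rot_group0 : rot_group 0 0.
Proof. by exists 0, 0, 0; split; ring. Qed.

Lemma rot_groupD x y x' y' :
  rot_group x y -> rot_group x' y' -> rot_group (x + x') (y + y').
Proof.
move=> h h'; rewrite -[x']opprK -[y']opprK; apply: rot_group_sub => //.
by rewrite -[- x']sub0r -[- y']sub0r; apply: rot_group_sub => //; exact: rot_group0.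
Qed.

Lemma rot_groupM x y (m : int) :
  rot_group x y -> rot_group (m%:~R * x) (m%:~R * y).
Proof.
move=> [n [p [q [-> ->]]]]; exists (m * n), (m * p), (m * q).
by rewrite !intrM; split; ring.
Qed.

(** Dirichlet's pigeonhole argument: [K * K + 1] multiples of [(a1, a2)] fall, modulo integers, into
    [K * K] squares of side below [e]. Two in one square differ by a short group element, whose
    first coordinate is nonzero because [a1] is irrational. *)
Lemma rot_group_small (e : R) : 0 < e ->
  exists x y, [/\ rot_group x y, x != 0, `|x| < e & `|y| < e].
Proof.
move=> e0; have [k hk] := invn_lt e0; set K := k.+1 in hk.
have K0 : 0 < K%:R :> R by rewrite ltr0n.
pose f (i : 'I_(K * K).+1) := (grid_index k (i%:R * a1), grid_index k (i%:R * a2)).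
have /injectivePn [i [j ij fij]] : ~~ injectiveb f.
  apply/negP => /injectiveP /leq_card; rewrite card_prod !card_ord; lia.
case: fij => e1 e2.
have close x y : grid_index k x = grid_index k y -> `|fpart x - fpart y| < e.
  move=> bxy; have := grid_indexP k x; have := grid_indexP k y; rewrite bxy => h1 h2.
  apply: lt_trans hk; rewrite -(ltr_pM2l K0) divff ?gt_eqF //.
  rewrite -{1}(gtr0_norm K0) -normrM mulrBr ltr_norml; move: h1 h2; rewrite -/K.
  by move: (K%:R * fpart x) (K%:R * fpart y) => a b; lra.
have nz : (i : int) - (j : int) != 0.
  by rewrite subr_eq0 eqz_nat; apply: contra ij => /eqP h; apply/eqP/val_inj.
exists (fpart (i%:R * a1) - fpart (j%:R * a1)), (fpart (i%:R * a2) - fpart (j%:R * a2)).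
have Gxy : rot_group (fpart (i%:R * a1) - fpart (j%:R * a1)) (fpart (i%:R * a2) - fpart (j%:R * a2)).
  exists ((i : int) - (j : int)), (Num.floor (j%:R * a1) - Num.floor (i%:R * a1)),
    (Num.floor (j%:R * a2) - Num.floor (i%:R * a2)).
  by rewrite !intrB /fpart; split; ring.
split=> //; [|exact: close|exact: close].
apply/eqP => h0.
have [|h _ _] := kronecker_int (p := (i : int) - (j : int)) (q := 0)
   (r := Num.floor (j%:R * a1) - Num.floor (i%:R * a1)).
  by rewrite -[RHS]h0 !intrB /fpart; ring.
by rewrite h eqxx in nz.
Qed.

(** If two short elements of the group are linearly independent, rounding down the coordinates of
    [(X, Y)] in this basis gives a group element close to it. *)
Lemma rot_group_dense (e X Y : R) : 0 < e ->
  exists x y, [/\ rot_group x y, `|x - X| < e & `|y - Y| < e].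
Proof.
move=> e0.
have [[x1 [y1 [x2 [y2 [G1 G2 [s1 t1 s2 t2] det]]]]]|nondeg] :=
  pselect (exists x1 y1 x2 y2, [/\ rot_group x1 y1, rot_group x2 y2,
   [/\ `|x1| < e / 2, `|y1| < e / 2, `|x2| < e / 2 & `|y2| < e / 2] &
   x1 * y2 - y1 * x2 != 0]).
  pose d := x1 * y2 - y1 * x2.
  pose s := (X * y2 - Y * x2) / d; pose t := (x1 * Y - y1 * X) / d.
  have XE : X = s * x1 + t * x2 by rewrite /s /t /d; field.
  have YE : Y = s * y1 + t * y2 by rewrite /s /t /d; field.
  exists ((Num.floor s)%:~R * x1 + (Num.floor t)%:~R * x2),
         ((Num.floor s)%:~R * y1 + (Num.floor t)%:~R * y2).
  have Gst : rot_group ((Num.floor s)%:~R * x1 + (Num.floor t)%:~R * x2)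
      ((Num.floor s)%:~R * y1 + (Num.floor t)%:~R * y2).
    by apply: rot_groupD; exact: rot_groupM.
  have := floor_itv s; have := floor_itv t; rewrite !intrD; move: Gst.
  move: (Num.floor s)%:~R (Num.floor t)%:~R => S T Gst hT hS.
  have bnd (a b : R) : `|a| < e / 2 -> `|b| < e / 2 ->
      `|S * a + T * b - (s * a + t * b)| < e.
    move=> ha hb; have -> : S * a + T * b - (s * a + t * b) = (S - s) * a + (T - t) * b by ring.
    have p1 : `|(S - s) * a| <= `|a|.
      by rewrite normrM ler_piMl // ler_norml; lra.
    have p2 : `|(T - t) * b| <= `|b|.
      by rewrite normrM ler_piMl // ler_norml; lra.
    by have := ler_normD ((S - s) * a) ((T - t) * b); lra.
  by split; [|rewrite XE; exact: bnd|rewrite YE; exact: bnd].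
(* Otherwise all small elements of the group are collinear; the group then has a
   discrete image under the linear form vanishing on their common line, and
   this yields a rational relation. *)
exfalso.
have e4 : 0 < e / 4 by lra.
have [x0 [y0 [G0 x00 sx0 sy0]]] := rot_group_small e4.
pose f x y := x0 * y - y0 * x.
have small0 x y : rot_group x y -> `|x| < e / 2 -> `|y| < e / 2 -> f x y = 0.
  move=> Gxy sx sy; apply/eqP; apply: contra_notT nondeg => h.
  exists x0, y0, x, y; split=> //; split => //; lra.
pose H h := exists x y, rot_group x y /\ h = f x y.
have [c hc] : exists c, forall x, H x -> exists m : int, x = c * m%:~R.
  apply: (@discrete_subgroup_cyclic R H (`|x0| * (e / 4)) x0) => //.
  - move=> _ _ [x [y [Gxy ->]]] [x' [y' [Gxy' ->]]].
    exists (x - x'), (y - y'); split; first exact: rot_group_sub.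
    by rewrite /f; ring.
  - by rewrite mulr_gt0 // normr_gt0.
  - move=> _ [x [y [Gxy ->]]] fs.
    (* Subtracting [m] times [(x0, y0)] keeps the value of [f] and makes the element short, so that
       [small0] applies. *)
    pose m := Num.floor (x / x0).
    have := floor_itv (x / x0); rewrite -/m intrD => hm.
    have Gw : rot_group (x - m%:~R * x0) (y - m%:~R * y0).
      by apply: rot_group_sub => //; exact: rot_groupM.
    have -> : f x y = f (x - m%:~R * x0) (y - m%:~R * y0) by rewrite /f; ring.
    have fr1 : `|x / x0 - m%:~R| <= 1 by rewrite ler_norml; lra.
    apply: small0 => //.
      have -> : x - m%:~R * x0 = (x / x0 - m%:~R) * x0 by field.
      by rewrite normrM; have := ler_piMl (normr_ge0 x0) fr1; lra.
    have -> : y - m%:~R * y0 = f x y / x0 + (x / x0 - m%:~R) * y0.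
      by rewrite /f; field.
    have p1 : `|f x y / x0| < e / 4.
      by rewrite normrM normfV ltr_pdivrMr ?normr_gt0 // mulrC.
    have p2 : `|(x / x0 - m%:~R) * y0| <= `|y0| by rewrite normrM ler_piMl.
    by have := ler_normD (f x y / x0) ((x / x0 - m%:~R) * y0); lra.
  - exists 0, 1; split; last by rewrite /f; ring.
    by exists 0, 0, 1; split; ring.
(* The values of the form at [(0, 1)], [(1, 0)] and [(a1, a2)] are [c] times integers [p], [q], [r].
   Hence [q * a1 + p * a2 = r], which forces [p = 0] and contradicts [x0 != 0]. *)
have [p hp] : exists m : int, x0 = c * m%:~R.
  apply: hc; exists 0, 1; split; last by rewrite /f; ring.
  by exists 0, 0, 1; split; ring.
have [q hq] : exists m : int, - y0 = c * m%:~R.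
  apply: hc; exists 1, 0; split; last by rewrite /f; ring.
  by exists 0, 1, 0; split; ring.
have [r hr] : exists m : int, x0 * a2 - y0 * a1 = c * m%:~R.
  apply: hc; exists a1, a2; split; last by rewrite /f; ring.
  by exists 1, 0, 0; split; ring.
have c0 : c != 0 by apply: contra_neq x00 => c0; rewrite hp c0 mul0r.
have [|_ p0 _] := kronecker_int (p := q) (q := p) (r := - r).
  apply: (mulfI c0); rewrite mulr0 mulrNz !mulrDr mulrN -hr !mulrA -hq -hp; ring.
by move: x00; rewrite hp p0 mulr0 eqxx.
Qed.

(** Compactness of the torus, by means of a finite grid: density is applied at the finitely many
    grid points with half the tolerance, and the largest multiplier is kept. *)
Lemma rot_uniform (e : R) : 0 < e -> exists N : nat, forall X Y,
  exists n p q : int, [/\ (`|n| <= N)%N, `|n%:~R * a1 + p%:~R - X| < e &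
    `|n%:~R * a2 + q%:~R - Y| < e].
Proof.
move=> e0; have e2 : 0 < e / 2 by lra.
have [k hk] := invn_lt e2; have K0 : 0 < k.+1%:R :> R by rewrite ltr0n.
pose P (ij : 'I_k.+1 * 'I_k.+1) (N : nat) := exists n p q : int,
  [/\ (`|n| <= N)%N, `|n%:~R * a1 + p%:~R - ij.1%:R / k.+1%:R| < e / 2 &
    `|n%:~R * a2 + q%:~R - ij.2%:R / k.+1%:R| < e / 2].
have [] := @seq_uniform_bound _ (enum {: 'I_k.+1 * 'I_k.+1}) P.
- move=> ij m n mn [x [p [q [h1 h2 h3]]]]; exists x, p, q; split=> //.
  exact: leq_trans mn.
- move=> ij _.
  have [_ [_ [[n [p [q [-> ->]]]] h1 h2]]] :=
    rot_group_dense (ij.1%:R / k.+1%:R) (ij.2%:R / k.+1%:R) e2.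
  by exists `|n|%N, n, p, q.
move=> N hN; exists N => X Y.
have [n [p [q [hn h1 h2]]]] := hN (grid_index k X, grid_index k Y) (mem_enum _ _).
exists n, (p + Num.floor X), (q + Num.floor Y); rewrite !intrD; split=> //.
- have := grid_indexP k X; rewrite /= in h1.
  rewrite -ler_pdivrMl // -ltr_pdivlMl // mulrDr mulr1.
  by move: h1 hk; move: (k.+1%:R^-1) => A; rewrite /fpart !ltr_norml; lra.
- have := grid_indexP k Y; rewrite /= in h2.
  rewrite -ler_pdivrMl // -ltr_pdivlMl // mulrDr mulr1.
  by move: h2 hk; move: (k.+1%:R^-1) => A; rewrite /fpart !ltr_norml; lra.
Qed.

(** At the times [lam * (th + k)] with [k] an integer, the third coordinate agrees with that of [y]
    modulo 1, and the first two move by the rotation by [(a1, a2)]. Replacing [n] by [n + N] makes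
    the time nonnegative. *)
Lemma torus_line_uniform (lam e : R) : 0 < lam -> 0 < e ->
  exists2 T : R, 0 <= T & forall z y : pt R, exists t (m : 'I_3 -> int),
    0 <= t <= T /\
    forall j, `|z j + t * (dirv a1 a2 j / lam) + (m j)%:~R - y j| < e.
Proof.
move=> lam0 e0; have [N hN] := rot_uniform e0.
have N0 : 0 <= N%:R :> R by [].
exists (lam * (2 * N%:R + 1)); first by rewrite mulr_ge0 //; lra.
move=> z y; pose th := fpart (y 2 - z 2); have := fpart_itv (y 2 - z 2); rewrite -/th => hth.
have [n [p [q [hn h1 h2]]]] := hN (y 0 - z 0 - (th + N%:R) * a1) (y 1 - z 1 - (th + N%:R) * a2).
have hn' : - N%:R <= (n%:~R : R) <= N%:R.
  by rewrite -ler_norml -intr_norm -[leRHS]/((N%:Z)%:~R) ler_int; lia.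
exists (lam * (th + n%:~R + N%:R)),
  (fun j => if j == 0 :> nat then p else if j == 1 :> nat then q
            else Num.floor (y 2 - z 2) - n - N%:Z).
split.
  apply/andP; split; first by rewrite mulr_ge0 //; lra.
  by rewrite ler_pM2l //; lra.
have E (a : R) : lam * (th + n%:~R + N%:R) * (a / lam) = (th + n%:~R + N%:R) * a.
  by field; rewrite gt_eqF.
move=> j; rewrite E /dirv; case: (ord3P j) => -> /=.
- rewrite (_ : _ - _ = n%:~R * a1 + p%:~R - (y 0 - z 0 - (th + N%:R) * a1)) //; ring.
- rewrite (_ : _ - _ = n%:~R * a2 + q%:~R - (y 1 - z 1 - (th + N%:R) * a2)) //; ring.
- by rewrite (_ : _ - _ = 0) ?normr0 // !intrB /th /fpart; ring.
Qed.

End Kronecker.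

(** * Uniform radii over finite sets, and avoidance of countable sets *)

Lemma seq_uniform_pos (R : realType) (T : eqType) (s : seq T) (P : T -> R -> Prop) :
  (forall x d d', 0 < d' <= d -> P x d -> P x d') ->
  (forall x, x \in s -> exists2 d, 0 < d & P x d) ->
  exists2 d, 0 < d & forall x, x \in s -> P x d.
Proof.
move=> mono H.
have [] := @seq_uniform_bound _ s (fun x n => P x n.+1%:R^-1).
- move=> x m n mn; apply: mono; rewrite invSn_gt0 /=.
  by rewrite lef_pV2 ?posrE ?ltr0n // ler_nat.
- move=> x /H[d d0 Pd]; have [n hn] := invn_lt d0.
  by exists n; apply: mono Pd; rewrite invSn_gt0 ltW.
by move=> n hn; exists n.+1%:R^-1; rewrite ?invSn_gt0.
Qed.

Lemma fin_uniform_pos (R : realType) (T : finType) (P : T -> R -> Prop) :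
  (forall x d d', 0 < d' <= d -> P x d -> P x d') ->
  (forall x, exists2 d, 0 < d & P x d) ->
  exists2 d, 0 < d & forall x, P x d.
Proof.
move=> mono H; have [d d0 hd] := @seq_uniform_pos R T (enum T) P mono (fun x _ => H x).
by exists d => // x; apply: hd; rewrite mem_enum.
Qed.

Lemma interval_avoids_countable (R : realType) (T : countType) (f : T -> R) (e : R) :
  0 < e -> exists2 s, 0 < s < e & forall x, f x != s.
Proof.
move=> e0; apply: contrapT => h.
have sub : `]0, e[%classic `<=` range f.
  move=> s /=; rewrite in_itv /= => s0e; apply: contrapT => ns; apply: h.
  by exists s => // x; apply/eqP => fx; apply: ns; exists x.
have cnt : countable (`]0, e[%classic : set R).
  apply: (sub_countable (subset_card_le sub)).
  exact: (sub_countable (card_image_le _ _)).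
have := countable_lebesgue_measure0 cnt.
by rewrite lebesgue_measure_itv /= lte_fin e0 oppr0 adde0 => -[]; lra.
Qed.

(** * Sheets and their transport along lines *)

Section Gluing.
Variables (M : seq cell) (sigma : face -> face).
Hypothesis pairing : face_pairing M sigma.

(** The permutation of the sheets made by crossing a wall orthogonal to axis [i], upwards when [h]
    is true and downwards otherwise. *)
Definition glued (i : 'I_3) (h : bool) (c : cell) : cell :=
  if neighbor (Face c i h) \in M then neighbor (Face c i h)
  else fcell (sigma (Face c i h)).

Lemma glued_in i h c : c \in M -> glued i h c \in M.
Proof.
move=> cM; rewrite /glued; case: ifPn => // nM.
by have [[]] := pairing (conj cM nM : boundary_face M (Face c i h)).
Qed.

Lemma gluedK i h c : c \in M -> glued i (~~ h) (glued i h c) = c.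
Proof.
move=> cM; rewrite {2}/glued; case: ifPn => nM.
  have E : neighbor (Face (neighbor (Face c i h)) i (~~ h)) = c.
    rewrite /neighbor /= /shift; apply/ffunP => j; rewrite !ffunE.
    by case: eqP => // _; case: h {nM} => /=; lia.
  by rewrite /glued E cM.
have [[fM nfM] ax hi sK] := pairing (conj cM nM : boundary_face M (Face c i h)).
have E : Face (fcell (sigma (Face c i h))) i (~~ h) = sigma (Face c i h).
  by move: ax hi; case: (sigma _) => a b d /= -> ->.
by rewrite /glued E (negbTE nfM) sK.
Qed.

Lemma glued_inj i h : {in M &, injective (glued i h)}.
Proof. by move=> c d cM dM /(congr1 (glued i (~~ h))); rewrite !gluedK. Qed.

End Gluing.

(** * Positions relative to the cubic lattice *)

Section Points.
Variable R : realType.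
Implicit Types (x y z u : pt R).

Definition int_coord x (j : 'I_3) : Prop := (Num.floor (x j))%:~R = x j.
Definition generic x : Prop := forall j, ~ int_coord x j.
(** The points of lattice edges, around which the cover may branch. *)
Definition singular x : Prop :=
  exists i j, [/\ i != j, int_coord x i & int_coord x j].
Definition eclose (e : R) x y : Prop := forall j, `|y j - x j| < e.
Definition pshift (m : 'I_3 -> int) x : pt R := fun j => x j + (m j)%:~R.

Lemma floor_shift (a : R) (m : int) : Num.floor (a + m%:~R) = Num.floor a + m.
Proof. by rewrite floorDrz ?intr_int // intrKfloor. Qed.

Lemma int_coordP x j (m : int) : x j = m%:~R -> int_coord x j.
Proof. by rewrite /int_coord => ->; rewrite intrKfloor. Qed.

Lemma int_coord_shift m x j : int_coord (pshift m x) j <-> int_coord x j.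
Proof.
rewrite /int_coord /pshift floor_shift intrD.
by split => [|->//]; move/addIr.
Qed.

Lemma generic_shift m x : generic (pshift m x) <-> generic x.
Proof. by split => h j /(int_coord_shift m x j); apply: h. Qed.

Lemma singular_shift m x : singular (pshift m x) <-> singular x.
Proof.
split=> -[i [j [ij hi hj]]]; exists i, j; split=> //; exact/(int_coord_shift m).
Qed.

Lemma pmove_shift m x t u : pmove (pshift m x) t u = pshift m (pmove x t u).
Proof. by apply/funext => j; rewrite /pmove /pshift; ring. Qed.

Lemma pmoveD x t s u : pmove (pmove x t u) s u = pmove x (t + s) u.
Proof. by apply/funext => j; rewrite /pmove; ring. Qed.

Lemma pmove0 x u : pmove x 0 u = x.
Proof. by apply/funext => j; rewrite /pmove; ring. Qed.

Lemma eclose_le e e' x y : e <= e' -> eclose e x y -> eclose e' x y.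
Proof. by move=> ee h j; apply: lt_le_trans ee. Qed.

Lemma eclose_trans e e' x y z : eclose e x y -> eclose e' y z -> eclose (e + e') x z.
Proof.
move=> h h' j; have := h j; have := h' j; rewrite !ltr_norml; lra.
Qed.

Lemma eclose_pmove e x y t u : eclose e x y -> eclose e (pmove x t u) (pmove y t u).
Proof. by move=> h j; rewrite /pmove [X in `|X|](_ : _ = y j - x j); [exact: h|ring]. Qed.

Lemma eclose_shift e m x y : eclose e x y -> eclose e (pshift m x) (pshift m y).
Proof. by move=> h j; rewrite /pshift [X in `|X|](_ : _ = y j - x j); [exact: h|ring]. Qed.

Lemma nonint_near (a : R) : (Num.floor a)%:~R <> a ->
  exists2 d, 0 < d & forall b : R, `|b - a| < d ->
    Num.floor b = Num.floor a /\ (Num.floor b)%:~R <> b.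
Proof.
move=> na; have := floor_itv a; rewrite intrD => /andP[f0 f1].
have f0' : (Num.floor a)%:~R < a by rewrite lt_neqAle f0 andbT; apply/eqP.
exists (Order.min (a - (Num.floor a)%:~R) ((Num.floor a)%:~R + 1 - a)).
  by rewrite lt_min; apply/andP; split; lra.
move=> b; rewrite lt_min !ltr_norml => h.
have E : Num.floor b = Num.floor a by apply: floor_def; rewrite intrD; lra.
by split=> //; rewrite E; lra.
Qed.

Lemma punctured_nonint (a : R) : exists2 d, 0 < d & forall b : R,
  0 < `|b - a| < d -> (Num.floor b)%:~R <> b.
Proof.
have [h|/nonint_near[d d0 hd]] := pselect ((Num.floor a)%:~R = a); last first.
  by exists d => // b /andP[_ /hd[]].
exists 1 => // b /andP[b0 b1] hb; move: b0 b1; rewrite -hb -h -intrB -intr_norm.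
by rewrite ltr0z ltrz1; lia.
Qed.

Lemma generic_near x : generic x -> exists2 d, 0 < d & forall y, eclose d x y ->
  generic y /\ forall j, Num.floor (y j) = Num.floor (x j).
Proof.
move=> gx; have [] := @fin_uniform_pos R 'I_3 (fun j d => forall b : R, `|b - x j| < d ->
    Num.floor b = Num.floor (x j) /\ (Num.floor b)%:~R <> b).
- by move=> j d d' /andP[_ dd] h b hb; apply: h; apply: lt_le_trans dd.
- by move=> j; apply: nonint_near; exact: gx.
by move=> d d0 hd; exists d => // y hy; split=> j; have [] := hd j _ (hy j).
Qed.

Lemma pmove_near (u : pt R) (e : R) : 0 < e -> exists2 d, 0 < d &
  forall x s s', `|s' - s| < d -> eclose e (pmove x s u) (pmove x s' u).
Proof.
move=> e0; have [] := @fin_uniform_pos R 'I_3 (fun j d => forall s s' : R, `|s' - s| < d ->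
   `|s' * u j - s * u j| < e).
- by move=> j d d' /andP[_ dd] h s s' hb; apply: h; apply: lt_le_trans dd.
- move=> j; exists (e / (1 + `|u j|)); first by rewrite divr_gt0 // ltr_wpDr.
  move=> s s' h; rewrite -mulrBl normrM.
  have u1 : 0 < 1 + `|u j| by rewrite ltr_wpDr.
  move: h; rewrite ltr_pdivlMr // mulrDr mulr1.
  have := normr_ge0 (s' - s); lra.
move=> d d0 hd; exists d => // x s s' h j; rewrite /pmove.
by rewrite (_ : _ - _ = s' * u j - s * u j); [exact: hd|ring].
Qed.

Lemma punctured_generic (u : pt R) x s : (forall j, u j != 0) ->
  exists2 d, 0 < d & forall s', 0 < `|s' - s| < d -> generic (pmove x s' u).
Proof.
move=> u0; have [] := @fin_uniform_pos R 'I_3 (fun j d => forall s' : R, 0 < `|s' - s| < d ->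
   ~ int_coord (pmove x s' u) j).
- move=> j d d' /andP[_ dd] h s' /andP[h1 h2]; apply: h; rewrite h1 /=.
  exact: lt_le_trans dd.
- move=> j; have [d d0 hd] := punctured_nonint (pmove x s u j).
  have uj : 0 < `|u j| by rewrite normr_gt0.
  exists (d / `|u j|); first by rewrite divr_gt0.
  move=> s' /andP[h1 h2]; apply: hd.
  rewrite (_ : _ - _ = (s' - s) * u j); last by rewrite /pmove; ring.
  by rewrite normrM mulr_gt0 //= -ltr_pdivlMr.
by move=> d d0 hd; exists d => // s' hs' j; exact: hd.
Qed.

End Points.

(** * Itineraries: transport of sheets along lines *)

Section Itineraries.
Variables (R : realType) (M : seq cell) (sigma : face -> face) (u : pt R).
Hypothesis pairing : face_pairing M sigma.
Hypothesis u_neq0 : forall j, u j != 0.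
Implicit Types (x y z : pt R).

(** The cubes of [x] and [y], read off from the floors of the coordinates, are equal or share a face
    orthogonal to axis [i]; [f] is the resulting map of sheets. The path from [x] to [y] does not
    enter. *)
Definition link x y (f : cell -> cell) : Prop := exists i : 'I_3,
  (forall j, j != i -> Num.floor (y j) = Num.floor (x j)) /\
  [\/ Num.floor (y i) = Num.floor (x i) /\ f = id,
      Num.floor (y i) = Num.floor (x i) + 1 /\ f = glued M sigma i true |
      Num.floor (x i) = Num.floor (y i) + 1 /\ f = glued M sigma i false].

Lemma link_eq_floor x y x' y' f :
  (forall j, Num.floor (x' j) = Num.floor (x j)) ->
  (forall j, Num.floor (y' j) = Num.floor (y j)) -> link x y f -> link x' y' f.
Proof.
move=> hx hy [i [h1 h2]]; exists i; rewrite hx hy; split=> // j ji.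
by rewrite hx hy h1.
Qed.

Lemma link_shift m x y f : link x y f -> link (pshift m x) (pshift m y) f.
Proof.
move=> [i [h1 h2]]; exists i; split=> [j ji|]; rewrite /pshift !floor_shift.
  by rewrite h1.
by case: h2 => -[h2 ->]; [constructor 1|constructor 2|constructor 3]; split=> //;
  rewrite h2; lia.
Qed.

Lemma link_perm x y f : link x y f ->
  (forall c, c \in M -> f c \in M) /\ {in M &, injective f}.
Proof.
move=> [i [_ [[_ ->]|[_ ->]|[_ ->]]]]; first by split.
all: by split=> [c|]; [exact: glued_in|exact: glued_inj].
Qed.

(* A straight line meeting no lattice edge crosses the walls one at a time, so
   near any of its points two cells on it are equal or share a face. *)
Lemma link_exists x : ~ singular x -> exists2 d, 0 < d &
  forall y y', eclose d x y -> eclose d x y' -> exists f, link y y' f.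
Proof.
move=> ns.
have [i hi] : exists i, forall j, j != i -> ~ int_coord x j.
  have [[i hi]|h] := pselect (exists i, int_coord x i).
    by exists i => j ji hj; apply: ns; exists j, i.
  by exists 0 => j _ hj; apply: h; exists j.
have [d d0 hd] : exists2 d, 0 < d & forall j, j != i -> forall b : R, `|b - x j| < d ->
    Num.floor b = Num.floor (x j).
  apply: fin_uniform_pos.
    by move=> j e e' /andP[_ ee] h ji b hb; apply: h => //; apply: lt_le_trans ee.
  move=> j; have [->|ji] := eqVneq j i; first by exists 1.
  by have [d d0 hd] := nonint_near (hi j ji); exists d => // _ b /hd[].
exists (Order.min d (1 / 2)); first by rewrite lt_min d0; lra.
move=> y y' hy hy'.
have hyd : eclose d x y by apply: eclose_le hy; rewrite ge_min lexx.
have hyd' : eclose d x y' by apply: eclose_le hy'; rewrite ge_min lexx.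
have E j : j != i -> Num.floor (y' j) = Num.floor (y j) by move=> ji; rewrite !(hd j).
have yi : `|y i - x i| < 1 / 2 by apply: lt_le_trans (hy i) _; rewrite ge_min lexx orbT.
have yi' : `|y' i - x i| < 1 / 2 by apply: lt_le_trans (hy' i) _; rewrite ge_min lexx orbT.
have := floor_itv (y i); have := floor_itv (y' i); rewrite !intrD.
move: yi yi'; rewrite !ltr_norml => h1 h2 h3 h4.
have l1 : (Num.floor (y' i) < Num.floor (y i) + 2) by rewrite -(ltr_int R) intrD; lra.
have l2 : (Num.floor (y i) < Num.floor (y' i) + 2) by rewrite -(ltr_int R) intrD; lra.
have [e|[e|e]] : Num.floor (y' i) = Num.floor (y i) \/
   (Num.floor (y' i) = Num.floor (y i) + 1 \/ Num.floor (y i) = Num.floor (y' i) + 1) by lia.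
- by exists id, i; split=> //; constructor 1.
- by exists (glued M sigma i true), i; split=> //; constructor 2.
- by exists (glued M sigma i false), i; split=> //; constructor 3.
Qed.

(* The intermediate times need not be monotone: only the window [-n, n] matters. *)
Inductive itin (n : R) (z : pt R) : R -> (cell -> cell) -> Prop :=
| itin0 : itin n z 0 id
| itinS t f t' g : itin n z t f -> `|t'| <= n -> generic (pmove z t' u) ->
    link (pmove z t u) (pmove z t' u) g -> itin n z t' (g \o f).

Lemma itin_le n n' z t f : n <= n' -> itin n z t f -> itin n' z t f.
Proof.
move=> nn; elim=> [|{}t {}f t' g _ IH h1 h2 h3]; first exact: itin0.
by apply: itinS IH _ h2 h3; apply: le_trans nn.
Qed.

Lemma itin_perm n z t f : itin n z t f ->
  (forall c, c \in M -> f c \in M) /\ {in M &, injective f}.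
Proof.
elim=> [|{}t {}f t' g _ [IH1 IH2] _ _ /link_perm[l1 l2]]; first by split.
split=> [c cM|c d cM dM /= e]; first exact/l1/IH1.
by apply: IH2 => //; apply: l2 => //; exact: IH1.
Qed.

Lemma itin_generic n z t f : generic z -> itin n z t f -> generic (pmove z t u).
Proof. by move=> gz; case=> // ; rewrite pmove0. Qed.

Lemma itin_cat n n' n'' z t f t' f' : itin n z t f -> itin n' (pmove z t u) t' f' ->
  n <= n'' -> `|t| + n' <= n'' -> itin n'' z (t + t') (f' \o f).
Proof.
move=> h h' nn nn'; elim: h' => [|s g s' g' _ IH h1 h2 h3].
  by rewrite addr0; exact: itin_le nn h.
rewrite pmoveD in h2; rewrite !pmoveD in h3; rewrite -[_ \o f]/(g' \o (g \o f)).
by apply: itinS IH _ h2 h3; apply: le_trans (ler_normD _ _) _; lra.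
Qed.

Lemma itin_shift n m z t f : itin n z t f -> itin n (pshift m z) t f.
Proof.
elim=> [|{}t {}f t' g _ IH h1 h2 h3]; first exact: itin0.
apply: itinS IH h1 _ _; rewrite !pmove_shift; first exact/generic_shift.
exact: link_shift.
Qed.

(** An itinerary consults finitely many generic points. Each lies in an open lattice cube, so a
    small displacement of the start changes no floor. *)
Lemma itin_open n z t f : generic z -> itin n z t f ->
  exists2 d, 0 < d & forall z', eclose d z z' -> itin n z' t f.
Proof.
move=> gz; elim=> [|{}t {}f t' g h0 [d d0 IH] h1 h2 h3].
  by exists 1 => // z' _; exact: itin0.
have [d1 d10 hd1] := generic_near (itin_generic gz h0).
have [d2 d20 hd2] := generic_near h2.
exists (Order.min d (Order.min d1 d2)); first by rewrite !lt_min d0 d10 d20.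
move=> z' hz'.
have n1 : eclose d z z' by apply: eclose_le hz'; rewrite ge_min lexx.
have n2 : eclose d1 (pmove z t u) (pmove z' t u).
  by apply/eclose_pmove/(eclose_le _ hz'); rewrite !ge_min lexx orbT.
have n3 : eclose d2 (pmove z t' u) (pmove z' t' u).
  by apply/eclose_pmove/(eclose_le _ hz'); rewrite !ge_min lexx !orbT.
have [_ e1] := hd1 _ n2; have [g2 e2] := hd2 _ n3.
exact: itinS (IH _ n1) h1 g2 (link_eq_floor e1 e2 h3).
Qed.

(** Around every time of a nonsingular line any two generic times are joined by one link.
    Reachability is therefore locally constant in the rescaled time [r], and holds at [r = 0]. *)
Lemma itin_exists z t : generic z -> generic (pmove z t u) ->
  (forall r, 0 <= r <= 1 -> ~ singular (pmove z (r * t) u)) ->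
  exists f, itin `|t| z t f.
Proof.
move=> gz gt ns; have [->|t0] := eqVneq t 0; first by exists id; exact: itin0.
pose w : pt R := fun j => t * u j.
have pw r : pmove z (r * t) u = pmove z r w.
  by apply/funext => j; rewrite /pmove /w mulrA.
have w0 j : w j != 0 by rewrite mulf_neq0.
pose reach r := exists f, itin `|t| z (r * t) f.
(* An itinerary need not be able to stop at a wall, so [P r] speaks of all generic times near [r]
   instead of [r] itself. *)
pose P r := exists2 d, 0 < d & forall r', 0 <= r' <= 1 -> `|r' - r| < d ->
  generic (pmove z (r' * t) u) -> reach r'.
have loc r : 0 <= r <= 1 -> exists2 d, 0 < d & forall r' r'', 0 <= r' <= 1 ->
    0 <= r'' <= 1 -> `|r' - r| < d -> `|r'' - r| < d ->
    generic (pmove z (r'' * t) u) -> reach r' -> reach r''.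
  move=> hr; have [d d0 hd] := link_exists (ns r hr).
  have [e e0 he] := pmove_near w d0; exists e => // r' r'' h' h'' n' n'' g'' [f hf].
  have [] := hd (pmove z (r' * t) u) (pmove z (r'' * t) u); rewrite ?pw; try exact: he.
  move=> g; rewrite -!pw => hg; exists (g \o f); apply: itinS hf _ g'' hg.
  by rewrite normrM ler_piMl // ger0_norm; lra.
have dense r d : 0 <= r <= 1 -> 0 < d -> exists r',
    [/\ 0 <= r' <= 1, `|r' - r| < d & generic (pmove z (r' * t) u)].
  move=> hr d0; have [e e0 he] := punctured_generic z r w0.
  (* The bound [1 / 4] keeps the perturbed time in the unit interval, moving right from the left
     half and left from the right half. *)
  pose k := Order.min (1 / 4) (Order.min (d / 2) (e / 2)).
  have k0 : 0 < k by rewrite !lt_min; apply/and3P; split; lra.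
  have [k1 k2 k3] : [/\ k <= 1 / 4, k <= d / 2 & k <= e / 2].
    by split; rewrite !ge_min lexx ?orbT.
  have [r2|r2] := lerP r (1 / 2).
    have E : `|r + k - r| = k by rewrite addrC addKr gtr0_norm.
    by exists (r + k); split; rewrite ?E ?pw; [lra|lra|apply: he; rewrite E; lra].
  have E : `|r - k - r| = k by rewrite addrC addKr normrN gtr0_norm.
  by exists (r - k); split; rewrite ?E ?pw; [lra|lra|apply: he; rewrite E; lra].
have P1 : P 1.
  apply: locally_constant_segment => [r hr|].
    have [d d0 hd] := loc r hr; exists d => // y hy yr.
    split=> [[e e0 he]|[e e0 he]].
      have m0 : 0 < Order.min e (d - `|y - r|) by rewrite lt_min e0; lra.
      have [y' [y'01 + gy']] := dense y _ hy m0; rewrite lt_min => /andP[n1 n2].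
      exists d => // r' h' n' g'; apply: (hd y' r') => //; last exact: he.
      by have := ler_distD y y' r; lra.
    have m0 : 0 < Order.min e d by rewrite lt_min e0.
    have [y' [y'01 + gy']] := dense r _ hr m0; rewrite lt_min => /andP[n1 n2].
    exists (d - `|y - r|) => [|r' h' n' g']; first lra.
    apply: (hd y' r') => //; last exact: he.
    by have := ler_distD y r' r; lra.
  have [|d d0 hd] := loc 0; first lra.
  exists d => // r' h' n' g'; apply: (hd 0 r') => //; [lra|by rewrite subrr normr0|].
  by exists id; rewrite mul0r; exact: itin0.
have [d d0 /(_ 1)] := P1; rewrite subrr normr0 mul1r => /(_ _ d0 gt).
case; first lra.
by move=> f; rewrite mul1r => hf; exists f.
Qed.

End Itineraries.
(** * States avoiding a box *)

Section Minimality.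
Variables (R : realType) (M : seq cell) (sigma : face -> face) (u : pt R).
Hypothesis region : polycube_region M.
Hypothesis pairing : face_pairing M sigma.
Hypothesis u_indep : forall i j, i != j -> forall m n : int,
  m%:~R * u i = n%:~R * u j -> m = 0 /\ n = 0.
Hypothesis u_dense : forall e : R, 0 < e -> exists2 T : R, 0 <= T &
  forall z y : pt R, exists t (m : 'I_3 -> int), 0 <= t <= T /\
    eclose e y (pshift m (pmove z t u)).
Implicit Types (x y z : pt R).

Lemma dir_neq0 j : u j != 0.
Proof.
have [i ij] : exists i : 'I_3, i != j.
  by case: (ord3P j) => ->; [exists 1|exists 0|exists 0].
apply/eqP => uj; have [|_ //] := @u_indep i j ij 0 1.
by rewrite uj mul0r mulr0.
Qed.

(** Between two such times both coordinates change by integers, which would make [u i] and [u j]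
    rationally dependent. *)
Lemma singular_time_unique z i j t t' : i != j ->
  int_coord (pmove z t u) i -> int_coord (pmove z t u) j ->
  int_coord (pmove z t' u) i -> int_coord (pmove z t' u) j -> t = t'.
Proof.
move=> ij ha hb hc hd.
have ei : (t - t') * u i = (Num.floor (pmove z t u i) - Num.floor (pmove z t' u i))%:~R.
  by rewrite intrB ha hc /pmove; ring.
have ej : (t - t') * u j = (Num.floor (pmove z t u j) - Num.floor (pmove z t' u j))%:~R.
  by rewrite intrB hb hd /pmove; ring.
have [|h _] := u_indep ij (m := Num.floor (pmove z t u j) - Num.floor (pmove z t' u j))
  (n := Num.floor (pmove z t u i) - Num.floor (pmove z t' u i)).
  by rewrite -ei -ej; ring.
move: ej; rewrite h => /eqP; rewrite mulf_eq0 (negbTE (dir_neq0 j)) orbF subr_eq0.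
by move/eqP.
Qed.

(** * Lines through two lattice edges, and how to avoid them *)

Definition good z : Prop :=
  (forall t, 0 <= t -> ~ singular (pmove z t u)) \/
  (forall t, t <= 0 -> ~ singular (pmove z t u)).

(** The countably many coordinates possible for a point of an edge whose line meets an edge of
    another direction; [m = 0] gives the integers. *)
Definition special_value (k : 'I_3 * 'I_3 * int * int) : R :=
  let: (l, j, m, n) := k in n%:~R + m%:~R * (u l / u j).

(* A line through two lattice edges in different directions: the shared
   coordinate determines the time elapsed between them up to integers. *)
Lemma bad_line z : generic z -> ~ good z ->
  exists t, forall l, exists k, pmove z t u l = special_value k.
Proof.
move=> gz /not_orP[/existsNP[t /not_implyP[t0 /contrapT st]]].
move=> /existsNP[t' /not_implyP[t'0 /contrapT st']].
have tt : t != t'.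
  apply/eqP => tt; have t00 : t = 0 by lra.
  by case: st => i [j [_ hi _]]; move: hi; rewrite t00 pmove0; exact: gz.
case: st => i [j [ij hi hj]]; case: st' => i' [j' [ij' hi' hj']].
exists t => l.
have int_special a : int_coord (pmove z t u) a -> exists k, pmove z t u a = special_value k.
  by move=> h; exists (a, a, 0, Num.floor (pmove z t u a)); rewrite /= mul0r addr0 h.
have [->|li] := eqVneq l i; first exact: int_special.
have [->|lj] := eqVneq l j; first exact: int_special.
have shared k : int_coord (pmove z t u) k -> int_coord (pmove z t' u) k ->
    int_coord (pmove z t' u) l -> exists k, pmove z t u l = special_value k.
  move=> h1 h2 h3.
  exists (l, k, Num.floor (pmove z t u k) - Num.floor (pmove z t' u k),
     Num.floor (pmove z t' u l)).
  rewrite /= intrB h1 h2 h3 /pmove; field; exact: dir_neq0.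
have case3 (a : 'I_3) : [\/ a = i, a = j | a = l].
  exact: ord3_third.
(* The second edge is not parallel to the first: a line meets at most one edge of each direction,
   and the two times differ. *)
have contra : ~ (int_coord (pmove z t' u) i /\ int_coord (pmove z t' u) j).
  by move=> [hi2 hj2]; move/eqP: tt; apply; exact: (singular_time_unique ij hi hj).
move: ij' hi' hj'.
case: (case3 i') => ->; case: (case3 j') => -> => ij' hi' hj'; try by rewrite eqxx in ij'.
- by case: contra.
- exact: (shared i).
- by case: contra.
- exact: (shared j).
- exact: (shared i).
- exact: (shared j).
Qed.

(** With [proj1], the point where the line through [z] in direction [u] meets the plane of vanishing
    third coordinate. The pair labels the line. *)
Definition proj0 z : R := z 0 - z 2 * (u 0 / u 2).
Definition proj1 z : R := z 1 - z 2 * (u 1 / u 2).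

Lemma bad_proj : exists (T : countType) (f g : T -> R), forall z,
  generic z -> ~ good z -> exists k, proj0 z = f k /\ proj1 z = g k.
Proof.
pose I : countType := ('I_3 * 'I_3 * int * int)%type.
exists (I * I * I)%type,
  (fun k => special_value k.1.1 - special_value k.2 * (u 0 / u 2)),
  (fun k => special_value k.1.2 - special_value k.2 * (u 1 / u 2)).
move=> z gz /(bad_line gz)[t ht].
have [k0 h0] := ht 0; have [k1 h1] := ht 1; have [k2 h2] := ht 2.
exists (k0, k1, k2); rewrite /= -h0 -h1 -h2 /proj0 /proj1 /pmove.
by split; field; exact: dir_neq0.
Qed.

(** Moving the first coordinate by [s] moves [proj0] by [s], so only countably many [s] lead to a
    bad line. *)
Lemma good_near y e : generic y -> 0 < e -> exists z, [/\ eclose e y z, generic z & good z].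
Proof.
move=> gy e0; have [d d0 hd] := generic_near gy.
have [T [f [g bad]]] := bad_proj.
have m0 : 0 < Order.min e d by rewrite lt_min e0.
have [s /andP[s0 +] hs] := interval_avoids_countable (fun k => f k - proj0 y) m0.
rewrite lt_min => /andP[se sd].
pose z : pt R := fun j => if j == 0 then y j + s else y j.
have nz r : s < r -> eclose r y z.
  move=> sr j; rewrite /z; case: eqP => _; last by rewrite subrr normr0; lra.
  by rewrite addrC addKr gtr0_norm.
have [gz _] := hd z (nz _ sd).
exists z; split=> //; first exact: nz.
apply: contrapT => /(bad z gz)[k [hk _]].
move/eqP: (hs k); apply; rewrite -hk /proj0 /z /=; ring.
Qed.

(** Projected to the plane of lines, the segment from [p] must miss countably many points. Once
    [proj1] varies along it, thanks to [h], each bad point can be met at one parameter only and then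
    excludes one value of [s]. *)
Lemma good_segment p q e : generic p -> good p -> generic q ->
  (forall j, Num.floor (q j) = Num.floor (p j)) -> 0 < e ->
  exists q', [/\ eclose e q q', generic q',
    forall j, Num.floor (q' j) = Num.floor (p j) &
    forall r, 0 <= r <= 1 -> let z : pt R := fun j => p j + r * (q' j - p j) in
      generic z /\ good z].
Proof.
move=> gp good_p gq eqpq e0; have [d d0 hd] := generic_near gq.
have [T [f [g bad]]] := bad_proj.
pose m := Order.min e d.
have m0 : 0 < m by rewrite lt_min e0.
have [me md] : m <= e /\ m <= d by rewrite /m !ge_min !lexx orbT.
have [h [h0 hm hp]] : exists h, [/\ 0 <= h, h < m & proj1 q + h - proj1 p != 0].
  have [E|E] := eqVneq (proj1 q) (proj1 p).
    by exists (m / 2); split; [lra|lra|rewrite E; apply/eqP; lra].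
  by exists 0; split=> //; rewrite addr0 subr_eq0.
(* [rho k] is the only parameter at which the segment can meet the bad point [k]. When it is 0 the
   division below has no meaning, but the point of the segment is then [p], which is good. *)
pose rho k := (g k - proj1 p) / (proj1 q + h - proj1 p).
have [s /andP[s0 sm] hs] := interval_avoids_countable
  (fun k => (f k - proj0 p) / rho k + proj0 p - proj0 q) m0.
pose q' : pt R := fun j => if j == 0 then q j + s else if j == 1 then q j + h else q j.
have nq : eclose m q q'.
  move=> j; rewrite /q'; case: eqP => _; last case: eqP => _.
  - by rewrite addrC addKr gtr0_norm.
  - by rewrite addrC addKr ger0_norm.
  - by rewrite subrr normr0.
have [gq' eqq'] := hd _ (eclose_le md nq).
have eqp' j : Num.floor (q' j) = Num.floor (p j) by rewrite eqq'.
exists q'; split=> //; first exact: eclose_le nq.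
move=> r r01 z.
have gz : generic z.
  move=> j; have := floor_itv (p j); have := floor_itv (q' j); rewrite eqp' !intrD.
  have := gp j; have := gq' j; rewrite /int_coord eqp'.
  move: (Num.floor (p j)) => k /eqP n1 /eqP n2 /andP[a1 a2] /andP[b1 b2].
  have a3 : k%:~R < q' j by rewrite lt_neqAle n1.
  have b3 : k%:~R < p j by rewrite lt_neqAle n2.
  have zE : z j = (1 - r) * p j + r * q' j by rewrite /z; ring.
  have cvx (a b : R) : 0 < a -> 0 < b -> 0 < (1 - r) * a + r * b by move=> *; nra.
  have z1 : k%:~R < z j by rewrite zE; have := cvx (p j - k%:~R) (q' j - k%:~R); lra.
  have z2 : z j < k%:~R + 1.
    by rewrite zE; have := cvx (k%:~R + 1 - p j) (k%:~R + 1 - q' j); lra.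
  have -> : Num.floor (z j) = k by apply: floor_def; rewrite intrD; lra.
  by lra.
split=> //; apply: contrapT => nz; have [k [hk1 hk2]] := bad z gz nz.
have E0 : proj0 z = proj0 p + r * (proj0 q + s - proj0 p).
  by rewrite /proj0 /z /q' /=; ring.
have E1 : proj1 z = proj1 p + r * (proj1 q + h - proj1 p).
  by rewrite /proj1 /z /q' /=; ring.
have rE : rho k = r by rewrite /rho -hk2 E1; field.
have [r0|r0] := eqVneq r 0.
  apply: nz; rewrite (_ : z = p) //; apply/funext => j; rewrite /z r0; ring.
move/eqP: (hs k); apply; rewrite rE -hk1 E0; field.
exact: r0.
Qed.

(** * The limit set of avoiding states *)

Variables (c0 : cell) (f0 : pt R) (e0 : R).
Hypothesis c0M : c0 \in M.
Hypothesis e0_gt0 : 0 < e0.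
Hypothesis box_in : forall j, e0 < f0 j < 1 - e0.

Definition in_box z (c : cell) : Prop :=
  c = c0 /\ forall j, `|fpart (z j) - f0 j| < e0.

Definition avoids (n : R) z (c : cell) : Prop :=
  forall t f, itin M sigma u n z t f -> ~ in_box (pmove z t u) (f c).

(* The limit set of the states whose orbits avoid the box for longer and longer times. *)
Definition lim_avoid z (c : cell) : Prop :=
  forall (n : nat) (e : R), 0 < e -> exists2 z', eclose e z z' & avoids n%:R z' c.

Lemma in_box_shift m z c : in_box (pshift m z) c <-> in_box z c.
Proof.
have E j : fpart (pshift m z j) = fpart (z j).
  by rewrite /fpart /pshift floor_shift intrD; ring.
by split=> -[-> h]; split=> // j; [rewrite -E|rewrite E].
Qed.

Lemma avoids_shift n m z c : avoids n z c -> avoids n (pshift m z) c.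
Proof.
move=> h t f hf; rewrite pmove_shift => /in_box_shift; apply: h.
have -> : z = pshift (fun j => - m j) (pshift m z).
  by apply/funext => j; rewrite /pshift mulrNz; ring.
exact: itin_shift.
Qed.

Lemma avoids_le n n' z c : n <= n' -> avoids n' z c -> avoids n z c.
Proof. by move=> nn h t f /(itin_le nn); exact: h. Qed.

Lemma avoids_itin n n' z c t f : itin M sigma u n z t f -> avoids (n + n') z c ->
  0 <= n' -> `|t| <= n -> avoids n' (pmove z t u) (f c).
Proof.
move=> hf av n0 tn s g hg; rewrite pmoveD.
by apply: (av (t + s) (g \o f)); apply: itin_cat hf hg _ _; lra.
Qed.

Lemma lim_avoid_shift m z c : lim_avoid z c -> lim_avoid (pshift m z) c.
Proof.
move=> h n e e0'; have [z' nz' av] := h n e e0'.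
by exists (pshift m z'); [exact: eclose_shift|exact: avoids_shift].
Qed.

(** For each sheet the limit set is closed; as there are finitely many sheets, one radius serves
    them all. *)
Lemma lim_avoid_usc z : exists2 d, 0 < d & forall z' c, c \in M -> eclose d z z' ->
  lim_avoid z' c -> lim_avoid z c.
Proof.
have [] := @seq_uniform_pos R _ M (fun c d => forall z', eclose d z z' ->
  lim_avoid z' c -> lim_avoid z c).
- by move=> c d d' /andP[_ dd] h z' nz; apply: h; exact: eclose_le nz.
- move=> c _; have [h|] := pselect (lim_avoid z c); first by exists 1.
  move=> /existsNP[n /existsNP[e /not_implyP[e1 h]]].
  exists (e / 2); first lra.
  move=> z' nz /(_ n (e / 2))[|z'' nz' av]; first lra.
  case: h; exists z'' => //.
  by have := eclose_trans nz nz'; apply: eclose_le; lra.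
by move=> d d0 hd; exists d => // z' c cM nz; exact: (hd c cM z').
Qed.

(** Nearby states share the itinerary, and the move shortens their avoidance window by at most [n],
    which arbitrarily long windows absorb. *)
Lemma lim_avoid_itin z c n t f : generic z -> itin M sigma u n z t f -> `|t| <= n ->
  lim_avoid z c -> lim_avoid (pmove z t u) (f c).
Proof.
move=> gz hf tn h k e e1; have [d d0 hd] := itin_open gz hf.
have [N hN] := nat_ge (n + k%:R).
have m0 : 0 < Order.min d e by rewrite lt_min d0.
have [z' nz' av] := h N _ m0.
exists (pmove z' t u).
  by apply/eclose_pmove/(eclose_le _ nz'); rewrite ge_min lexx orbT.
apply: (avoids_itin (n := n)) => //; last exact: avoids_le hN av.
by apply: hd; apply: eclose_le nz'; rewrite ge_min lexx.
Qed.

Lemma lim_avoid_box z : (forall j, z j = f0 j) -> ~ lim_avoid z c0.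
Proof.
move=> zE /(_ 0%N _ e0_gt0)[z' nz' /(_ 0 id)]; rewrite pmove0.
case; first exact: itin0.
split=> // j; have := nz' j; rewrite zE ltr_norml => h.
have -> : fpart (z' j) = z' j.
  rewrite /fpart (_ : Num.floor _ = 0) ?subr0 //.
  by apply: floor_def; have := box_in j; lra.
by rewrite ltr_norml.
Qed.

(** Assumed for contradiction: nonsingular segments of every length that miss the box. *)
Hypothesis evading : forall n : nat, exists z c,
  [/\ generic z, c \in M,
      forall t, `|t| <= n%:R -> ~ singular (pmove z t u) & avoids n%:R z c].

(** If no sheet over [y] were in the limit set, one [n] would exclude avoidance near [y] on all
    sheets. An evading state, carried close to [y], violates this. *)
Lemma lim_avoid_neq0 y : generic y -> exists2 c, c \in M & lim_avoid y c.
Proof.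
move=> gy; apply: contrapT => none.
have [] := @seq_uniform_bound _ M (fun c n => forall z', eclose n.+1%:R^-1 y z' ->
   ~ avoids n%:R z' c).
- move=> c m n mn h z' nz av; apply: (h z').
    by apply: eclose_le nz; rewrite lef_pV2 ?posrE ?ltr0n // ler_nat.
  by apply: avoids_le av; rewrite ler_nat.
- move=> c cM; have /existsNP[n /existsNP[e /not_implyP[e1 h]]] : ~ lim_avoid y c.
    by move=> h; apply: none; exists c.
  have [k hk] := invn_lt e1; exists (maxn n k) => z' nz av; apply: h.
  exists z'; last by apply: avoids_le av; rewrite ler_nat leq_maxl.
  apply: eclose_le nz; apply: le_trans (ltW hk).
  by rewrite lef_pV2 ?posrE ?ltr0n // ler_nat ltnS leq_maxr.
move=> n hn; have [d d0 hd] := generic_near gy.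
have m0 : 0 < Order.min d n.+1%:R^-1 by rewrite lt_min d0 invSn_gt0.
have [T T0 hT] := u_dense m0.
have [N hN] := nat_ge (n%:R + T).
(* The window [N] covers the travel time to [y], at most [T], and a further [n]. *)
have [z [c [gz cM ns av]]] := evading N.
have [t [m [/andP[t0 tT] nt]]] := hT z y.
have n1 : eclose d y (pshift m (pmove z t u)) by apply: eclose_le nt; rewrite ge_min lexx.
have n2 : eclose n.+1%:R^-1 y (pshift m (pmove z t u)).
  by apply: eclose_le nt; rewrite ge_min lexx orbT.
have [/generic_shift gt _] := hd _ n1.
have [f hf] : exists f, itin M sigma u `|t| z t f.
  apply: itin_exists => //; first exact: dir_neq0.
  move=> r r01; apply: ns; rewrite ger0_norm; last by rewrite mulr_ge0 //; lra.
  by have := ler_piMl t0 (andP r01).2; have := ler0n R n; lra.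
have [fM _] := itin_perm pairing hf.
apply: (hn (f c) (fM _ cM) _ n2); apply: avoids_shift.
apply: (avoids_itin (n := T)) => //; first by apply: itin_le hf; rewrite ger0_norm.
  by apply: avoids_le av; lra.
by rewrite ger0_norm.
Qed.

Definition sheets z : seq cell := [seq c <- undup M | `[< lim_avoid z c >]].

Lemma sheets_uniq z : uniq (sheets z).
Proof. by rewrite filter_uniq // undup_uniq. Qed.

Lemma mem_sheets z c : c \in sheets z <-> c \in M /\ lim_avoid z c.
Proof.
by rewrite mem_filter mem_undup; split=> [/andP[/asboolP h ->]|[-> /asboolP ->]].
Qed.

(** The nonsingular half-orbit of [z] comes close to [y]. Transport along it is injective and
    preserves the limit set, and semicontinuity brings the transported sheets to [y] itself. *)
Lemma sheets_min z y : generic z -> good z -> generic y ->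
  (size (sheets z) <= size (sheets y))%N.
Proof.
move=> gz good_z gy.
have [d1 d10 hd1] := lim_avoid_usc y; have [d2 d20 hd2] := generic_near gy.
have m0 : 0 < Order.min d1 d2 by rewrite lt_min d10.
have [T T0 hT] := u_dense m0.
have [t [m [nt ns]]] : exists t (m : 'I_3 -> int),
    eclose (Order.min d1 d2) y (pshift m (pmove z t u)) /\
    forall r, 0 <= r <= 1 -> ~ singular (pmove z (r * t) u).
  case: good_z => h.
    have [t [m [/andP[t0 _] nt]]] := hT z y; exists t, m; split=> // r /andP[r0 _].
    by apply: h; rewrite mulr_ge0.
  (* For a backward half-orbit the density statement is applied from time [- T], so that the visit
     occurs at a time [t - T <= 0]. *)
  have [t [m [/andP[_ tT] nt]]] := hT (pmove z (- T) u) y.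
  exists (t - T), m; rewrite pmoveD [- T + t]addrC in nt; split=> // r /andP[r0 _].
  by apply: h; rewrite mulr_ge0_le0 // subr_le0.
have n1 : eclose d1 y (pshift m (pmove z t u)) by apply: eclose_le nt; rewrite ge_min lexx.
have n2 : eclose d2 y (pshift m (pmove z t u)).
  by apply: eclose_le nt; rewrite ge_min lexx orbT.
have [/generic_shift gt _] := hd2 _ n2.
have [f hf] : exists f, itin M sigma u `|t| z t f.
  by apply: itin_exists => //; exact: dir_neq0.
have [fM finj] := itin_perm pairing hf.
rewrite -(size_map f); apply: uniq_leq_size.
  rewrite map_inj_in_uniq ?sheets_uniq // => c d /mem_sheets[cM _] /mem_sheets[dM _].
  exact: finj.
move=> _ /mapP[c /mem_sheets[cM hc] ->]; apply/mem_sheets; split; first exact: fM.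
apply: (hd1 _ _ (fM _ cM) n1); apply: lim_avoid_shift.
exact: (lim_avoid_itin gz hf).
Qed.

(** Semicontinuity puts the sheets at [z'] among those at [z]; minimality of their number at the
    good point [z] turns the inclusion into an equality. *)
Lemma lim_avoid_locally_constant z : generic z -> good z ->
  exists2 d, 0 < d & forall z' c, c \in M -> eclose d z z' ->
    (lim_avoid z' c <-> lim_avoid z c).
Proof.
move=> gz good_z.
have [d1 d10 hd1] := lim_avoid_usc z; have [d2 d20 hd2] := generic_near gz.
exists (Order.min d1 d2); first by rewrite lt_min d10.
move=> z' c cM nz.
have n1 : eclose d1 z z' by apply: eclose_le nz; rewrite ge_min lexx.
have n2 : eclose d2 z z' by apply: eclose_le nz; rewrite ge_min lexx orbT.
have [gz' _] := hd2 _ n2.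
split; first exact: (hd1 z' c).
have sub : {subset sheets z' <= sheets z}.
  move=> d /mem_sheets[dM h]; apply/mem_sheets; split=> //; exact: (hd1 z' d).
have [_ E] := uniq_min_size (sheets_uniq z') sub (sheets_min gz good_z gz').
move=> h; have /mem_sheets[] // : c \in sheets z' by rewrite E; apply/mem_sheets.
Qed.

(** Sheets are locally constant along a segment of good points from [p] to some [q'] near [q];
    semicontinuity covers the last step to [q]. *)
Lemma lim_avoid_cell p q c : generic p -> good p -> c \in M -> lim_avoid p c ->
  generic q -> (forall j, Num.floor (q j) = Num.floor (p j)) -> lim_avoid q c.
Proof.
move=> gp good_p cM hp gq E; have [d d0 hd] := lim_avoid_usc q.
have [q' [nq _ _ seg]] := good_segment gp good_p gq E d0.
apply: (hd q' c cM nq).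
pose z r : pt R := fun j => p j + r * (q' j - p j).
have z1 : z 1 = q' by apply/funext => j; rewrite /z; ring.
rewrite -z1; apply: (locally_constant_segment (P := fun r => lim_avoid (z r) c)); last first.
  by rewrite (_ : z 0 = p) //; apply/funext => j; rewrite /z; ring.
move=> r /seg[gz good_z].
have [e e1 he] := lim_avoid_locally_constant gz good_z.
have [k k0 hk] := pmove_near (fun j => q' j - p j) e1.
by exists k => // y _ yr; apply: he => //; exact: (hk p).
Qed.

Lemma lim_avoid_all p q c : generic p -> good p -> c \in M -> lim_avoid p c ->
  generic q -> lim_avoid q c.
Proof.
move=> gp good_p cM hp gq.
pose m j := Num.floor (p j) - Num.floor (q j).
have -> : q = pshift (fun j => - m j) (pshift m q).
  by apply/funext => j; rewrite /pshift mulrNz; ring.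
apply: lim_avoid_shift; apply: (lim_avoid_cell gp) => //; first exact/generic_shift.
by move=> j; rewrite /pshift floor_shift /m; lia.
Qed.

(** The line through the centre [w] of a wall is followed from one side to the other, then displaced
    slightly so that its endpoint becomes good. *)
Lemma crossing i h : exists y t, [/\ generic y, generic (pmove y t u), good (pmove y t u) &
  link M sigma y (pmove y t u) (glued M sigma i h)].
Proof.
have q0 : 0 < 1 / 4 :> R by lra.
have [d d0 hd] := pmove_near u q0.
(* The sign places time [k] below the wall and time [- k] above it if [h] is true, and conversely
   otherwise. *)
pose k := (if h == (0 < u i) then - (d / 2) else d / 2).
pose w : pt R := fun j => if j == i then 0 else 1 / 2.
have kd : `|k - 0| < d by rewrite subr0 /k; case: ifP => _; rewrite ?normrN gtr0_norm; lra.
have kd' : `|- k - 0| < d by rewrite subr0 normrN -[k]subr0.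
have nw1 := hd w _ _ kd; have nw2 := hd w _ _ kd'; rewrite pmove0 in nw1 nw2.
have wj s j : eclose (1 / 4) w (pmove w s u) -> j != i ->
    Num.floor (pmove w s u j) = 0 /\ ~ int_coord (pmove w s u) j.
  move=> /(_ j); rewrite {2}/w ltr_norml => + ji; rewrite (negbTE ji) => hj.
  have E : Num.floor (pmove w s u j) = 0 by apply: floor_def; lra.
  by split=> //; rewrite /int_coord E; lra.
have wi s : eclose (1 / 4) w (pmove w s u) -> s * u i != 0 ->
    Num.floor (pmove w s u i) = (if 0 < s * u i then 0 else -1) /\
    ~ int_coord (pmove w s u) i.
  move=> /(_ i); rewrite /int_coord {2}/w eqxx ltr_norml.
  have -> : pmove w s u i = s * u i by rewrite /pmove /w eqxx add0r.
  move=> hi n0; have E : Num.floor (s * u i) = (if 0 < s * u i then 0 else -1).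
    case: ltP => s0; apply: floor_def; first by lra.
    have : s * u i < 0 by rewrite lt_neqAle n0.
    by lra.
  by split=> //; rewrite E; case: ltP => s0; [lra|move: n0; lra].
have ku : k * u i != 0.
  rewrite mulf_neq0 ?dir_neq0 // /k; case: ifP => _; apply/eqP; lra.
have ku' : - k * u i != 0 by rewrite mulNr oppr_eq0.
have sgn : (0 < k * u i) = ~~ h.
  have d2 : 0 < d / 2 by lra.
  have gen b : (0 < (if b == (0 < u i) then - (d / 2) else d / 2) * u i) = ~~ b.
    have := dir_neq0 i; case: b; case: (ltgtP 0 (u i)) => // ui _;
      by rewrite /= ?mulNr ?oppr_gt0 ?pmulr_rgt0 ?pmulr_rlt0 ?(lt_gtF ui) ?ui.
  exact: gen.
have sgn' : (0 < - k * u i) = h.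
  by rewrite mulNr oppr_gt0 lt_neqAle ku /= leNgt sgn negbK.
have g1 : generic (pmove w k u).
  by move=> j; have [->|/(wj k j nw1)[]//] := eqVneq j i; have [] := wi k nw1 ku.
have g2 : generic (pmove w (- k) u).
  by move=> j; have [->|/(wj _ j nw2)[]//] := eqVneq j i; have [] := wi _ nw2 ku'.
have L : link M sigma (pmove w k u) (pmove w (- k) u) (glued M sigma i h).
  exists i; split=> [j ji|].
    by have [-> _] := wj _ j nw1 ji; have [-> _] := wj _ j nw2 ji.
  have [-> _] := wi _ nw1 ku; have [-> _] := wi _ nw2 ku'; rewrite sgn sgn'.
  by case: h {k kd kd' nw1 nw2 ku ku' sgn sgn' g1 g2}; [constructor 2|constructor 3].
have [d1 d10 hd1] := generic_near g1; have [d2 d20 hd2] := generic_near g2.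
have m0 : 0 < Order.min d1 d2 by rewrite lt_min d10.
have [y [ny gy good_y]] := good_near g2 m0.
have n2 : eclose d2 (pmove w (- k) u) y by apply: eclose_le ny; rewrite ge_min lexx orbT.
have n1 : eclose d1 (pmove w k u) (pmove y (2 * k) u).
  have -> : pmove w k u = pmove (pmove w (- k) u) (2 * k) u.
    by rewrite pmoveD; congr pmove; ring.
  by apply/eclose_pmove/(eclose_le _ ny); rewrite ge_min lexx.
have [gy1 e1] := hd1 _ n1; have [_ e2] := hd2 _ n2.
have yE : pmove (pmove y (2 * k) u) (- (2 * k)) u = y by rewrite pmoveD subrr pmove0.
exists (pmove y (2 * k) u), (- (2 * k)); rewrite yE; split=> //.
exact: link_eq_floor e1 e2 L.
Qed.

(** The cubes lying wholly in the limit set are stable under crossing walls. One exists, so chains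
    of face-adjacent cubes lead to [c0], whose box cannot be in the limit set. *)
Lemma not_evading : False.
Proof.
pose full (c : cell) := c \in M /\ forall q, generic q -> lim_avoid q c.
have full_glued i h c : full c -> full (glued M sigma i h c).
  move=> [cM hc]; split; first exact: glued_in.
  have [y [t [gy gt good_t L]]] := crossing i h.
  move=> q gq; apply: (lim_avoid_all gt good_t _ _ gq); first exact: glued_in.
  have := itinS (itin0 M sigma u `|t| y) (lexx _) gt; rewrite pmove0 => /(_ _ L) hit.
  exact: (lim_avoid_itin gy hit (lexx _) (hc y gy)).
have full_path (s : seq cell) (c : cell) : full c -> all (fun x : cell => x \in M) s -> path face_adjb c s ->
    full (last c s).
  elim: s c => //= d s IH c fc /andP[dM sM] /andP[/existsP[i adj] ps].
  apply: IH => //.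
  have [h dE] : exists h, d = neighbor (Face c i h).
    by case/orP: adj => /eqP->; [exists true|exists false].
  by have := full_glued i h c fc; rewrite /glued -dE dM.
have f0g : generic f0.
  move=> j; have h := box_in j; have he := e0_gt0; rewrite /int_coord.
  have -> : Num.floor (f0 j) = 0 by apply: floor_def; lra.
  by rewrite mulr0z; lra.
have [y [_ gy good_y]] := good_near f0g ltr01.
have [c cM hc] := lim_avoid_neq0 gy.
have fc : full c by split=> // q gq; exact: (lim_avoid_all gy).
have [_ /(_ c c0 cM c0M)[s /andP[/andP[sM ps] /eqP E]]] := region.
have [_ h] := full_path s c fc sM ps; rewrite E in h.
exact: (lim_avoid_box (z := f0)) (h f0 f0g).
Qed.

End Minimality.
(** * Geodesic segments as itineraries *)

Section Geodesic.
Variables (R : realType) (M : seq cell) (sigma : face -> face) (u : pt R).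
Variable L : seq (pt R * R).
Hypothesis pairing : face_pairing M sigma.
Hypothesis geod : chain_ok M sigma u L.
Hypothesis L_neq0 : L != [::].
Implicit Types (x y z : pt R) (k : nat).

Definition piece k : pt R * R := nth ((fun _ => 0) : pt R, 0) L k.
Definition start k : R := \sum_(i < k) (piece i).2.

Lemma piece_in k : (k < size L)%N -> 0 <= (piece k).2 /\
  forall t, 0 <= t <= (piece k).2 -> inM M (pmove (piece k).1 t u).
Proof.
rewrite /piece => kL; move: geod; clear L_neq0 geod; elim: L k kL => // -[p s] [|[p' s'] l] IH k.
  by case: k.
by case: k => [_ [] //|k kL [_ _ _ /IH]]; exact.
Qed.

Lemma piece_next k : (k.+1 < size L)%N -> exists F,
  [/\ boundary_face M F, in_face F (pmove (piece k).1 (piece k).2 u),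
      (if fhigh F then 0 < u (faxis F) else u (faxis F) < 0),
      (exists2 e : R, 0 < e & forall t, 0 < t < e ->
          ~ inM M (pmove (piece k).1 ((piece k).2 + t) u)) &
      (piece k.+1).1 = padd (pmove (piece k).1 (piece k).2 u) (@Defs.ftrans R sigma F)].
Proof.
rewrite /piece => kL; move: geod; clear L_neq0 geod; elim: L k kL => // -[p s] [|[p' s'] l] IH k.
  by case: k.
by case: k => [_ [] //|k kL [_ _ _ /IH]]; exact.
Qed.

Lemma startS k : start k.+1 = start k + (piece k).2.
Proof. by rewrite /start big_ord_recr. Qed.

Lemma start0 : start 0 = 0.
Proof. by rewrite /start big_ord0. Qed.

Lemma start_size : start (size L) = seg_length L.
Proof. by rewrite /seg_length (big_nth ((fun _ => 0) : pt R, 0)) big_mkord. Qed.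

Lemma start_le k k' : (k <= k' <= size L)%N -> start k <= start k'.
Proof.
move=> /andP[+ kL]; elim: k' kL => [|k' IH] kL; first by rewrite leqn0 => /eqP->.
rewrite leq_eqVlt => /orP[/eqP->//|]; rewrite ltnS => /(IH (ltnW kL)) h.
by rewrite startS; have [] := piece_in kL; lra.
Qed.

(** Closed at both ends, so a junction belongs to both neighbouring pieces, and pieces of length
    zero are allowed. *)
Definition on_piece k (T : R) : Prop := (k < size L)%N /\ start k <= T <= start k.+1.

Lemma on_piece_exists T : 0 <= T <= seg_length L -> exists k, on_piece k T.
Proof.
rewrite -start_size => /andP[T0].
have : (0 < size L)%N by case: L L_neq0.
move: (leqnn (size L)); move: {1 3 4}(size L) => n; elim: n => // n IH nL _ h.
have [Tn|nT] := lerP T (start n); last by exists n; split=> //; lra.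
case: n IH nL Tn h => [|n] IH nL Tn h; first by exists 0%N; split=> //; move: Tn; rewrite start0; lra.
by apply: IH => //; exact: ltnW.
Qed.

Lemma fcorner_int (F : face) j :
  @fcorner R F j = (fcell F j + (if (j == faxis F) && fhigh F then 1 else 0))%:~R.
Proof. by rewrite /fcorner intrD; case: ifP. Qed.

Definition base : pt R := (piece 0).1.
(** Piece [k] prolonged to a full line and parametrised by the arclength of the whole segment; [T]
    may lie outside the piece. *)
Definition pos k (T : R) : pt R := pmove (piece k).1 (T - start k) u.

(** The identifications are integer translations, so modulo the lattice the whole segment is a
    single straight line. *)
Lemma pos_shift k : (k < size L)%N -> exists m, forall T,
  pos k T = pshift m (pmove base T u).
Proof.
elim: k => [|k IH] kL.
  exists (fun _ => 0) => T; apply/funext => j.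
  by rewrite /pos /pshift start0 subr0 addr0.
have [m hm] := IH (ltnW kL).
have [F [_ _ _ _ E]] := piece_next kL.
exists (fun j => m j + (fcell (sigma F) j + (if (j == faxis (sigma F)) && fhigh (sigma F) then 1 else 0)
   - (fcell F j + (if (j == faxis F) && fhigh F then 1 else 0)))) => T.
apply/funext => j; have := congr1 (fun x => x j) (hm T).
rewrite /pos E /pmove /padd /Defs.ftrans !fcorner_int /pshift /pmove startS [(m j + _)%:~R]intrD intrB; lra.
Qed.

Lemma pos_generic k T : (k < size L)%N -> (generic (pos k T) <-> generic (pmove base T u)).
Proof. by move=> /pos_shift[m ->]; exact: generic_shift. Qed.

Lemma floor_cell (a : R) (c : int) : c%:~R <= a <= c%:~R + 1 ->
  (Num.floor a)%:~R <> a -> Num.floor a = c.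
Proof.
move=> /andP[h1 h2] n; apply: floor_def; rewrite intrD h1 lt_neqAle h2 andbT.
by apply/eqP => E; apply: n; rewrite E -intrD1 intrKfloor.
Qed.

Definition cube_of x : cell := [ffun j => Num.floor (x j)].

Lemma cube_of_in x : generic x -> inM M x -> cube_of x \in M.
Proof.
move=> gx [c cM hc]; suff -> : cube_of x = c by [].
by apply/ffunP => j; rewrite ffunE; apply: floor_cell (hc j) (gx j).
Qed.

Lemma cube_of_pos k T : on_piece k T -> generic (pmove base T u) -> cube_of (pos k T) \in M.
Proof.
move=> [kL hT] g; apply: cube_of_in; first exact/pos_generic.
have [_] := piece_in kL; apply; move: hT; rewrite startS; lra.
Qed.

Lemma link_cube_of x y f : cube_of y \in M -> link M sigma x y f -> f (cube_of x) = cube_of y.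
Proof.
move=> yM [i [h1 h2]].
have nb h : Num.floor (y i) = Num.floor (x i) + (if h then 1 else -1) ->
    glued M sigma i h (cube_of x) = cube_of y.
  move=> e; have E : neighbor (Face (cube_of x) i h) = cube_of y.
    apply/ffunP => j; rewrite !ffunE /=; case: eqP => [->|/eqP ji]; first by rewrite e.
    by rewrite h1.
  by rewrite /glued E yM.
case: h2 => -[e ->]; [|exact: (nb true e)|by apply: (nb false); rewrite e /=; lia].
by apply/ffunP => j; rewrite !ffunE; have [->//|ji] := eqVneq j i; exact/esym/h1.
Qed.

Lemma link_sym x y f : link M sigma x y f ->
  exists2 g, link M sigma y x g & forall c, c \in M -> f (g c) = c.
Proof.
move=> [i [h1 h2]]; have h1' j : j != i -> Num.floor (x j) = Num.floor (y j).
  by move=> ji; rewrite h1.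
case: h2 => -[e ->].
- by exists id => //; exists i; split=> //; constructor 1.
- exists (glued M sigma i false); first by exists i; split=> //; constructor 3.
  by move=> c cM; exact: (gluedK pairing i false cM).
- exists (glued M sigma i true); first by exists i; split=> //; constructor 2.
  by move=> c cM; exact: (gluedK pairing i true cM).
Qed.

Lemma same_floor_between (a b q : R) : Num.floor a = Num.floor b ->
  (Num.floor a)%:~R <> a -> (Num.floor b)%:~R <> b ->
  a <= q <= b \/ b <= q <= a -> Num.floor q = Num.floor a /\ (Num.floor q)%:~R <> q.
Proof.
move=> e /eqP na /eqP nb h; have := floor_itv a; have := floor_itv b; rewrite -e !intrD.
rewrite -e in nb; move: na nb; move: (Num.floor a) => n na nb /andP[b1 b2] /andP[a1 a2].
have a3 : n%:~R < a by rewrite lt_neqAle na.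
have b3 : n%:~R < b by rewrite lt_neqAle nb.
have E : Num.floor q = n by apply: floor_def; rewrite intrD; case: h; lra.
by split=> //; rewrite E; case: h; lra.
Qed.

Lemma between_pmove x (s t : R) j : 0 <= s <= t ->
  x j <= pmove x s u j <= pmove x t u j \/ pmove x t u j <= pmove x s u j <= x j.
Proof.
rewrite /pmove => /andP[s0 st]; have [u0|u0] := lerP 0 (u j).
  by left; rewrite lerDl lerD2l mulr_ge0 //= ler_wpM2r.
by right; apply/andP; split; nra.
Qed.

(* Crossing a glued face: [T2] may lie beyond the end of the piece [k.+1]. *)
Lemma cross_face k T1 T2 f : (k.+1 < size L)%N -> start k <= T1 <= start k.+1 ->
  start k.+1 <= T2 -> generic (pmove base T1 u) -> generic (pmove base T2 u) ->
  link M sigma (pmove base T1 u) (pmove base T2 u) f ->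
  [/\ f (cube_of (pos k T1)) \in M, f (cube_of (pos k T1)) = cube_of (pos k.+1 T2) &
      forall j, (f (cube_of (pos k T1)) j)%:~R <= (piece k.+1).1 j
                 <= (f (cube_of (pos k T1)) j)%:~R + 1].
Proof.
move=> kL /andP[T1l T1r] T2l g1 g2 lk.
have kL' := ltnW kL.
have [m hm] := pos_shift kL'.
set x := pos k T1; pose y := pos k T2; pose q := pos k (start k.+1).
have gx : generic x by apply/pos_generic.
have gy : generic y by apply/pos_generic.
have [i [l1 l2]] : link M sigma x y f by rewrite /x /y !hm; exact: link_shift.
have qE : q = pmove (piece k).1 (piece k).2 u.
  by rewrite /q /pos startS; congr pmove; ring.
have qx : q = pmove x (start k.+1 - T1) u.
  by rewrite /q /x /pos pmoveD; congr pmove; ring.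
have yx : y = pmove x (T2 - T1) u.
  by rewrite /y /x /pos pmoveD; congr pmove; ring.
have btw j : x j <= q j <= y j \/ y j <= q j <= x j.
  by rewrite qx yx; apply: between_pmove; lra.
have [F [bF [inF1 inF2] out _ nextE]] := piece_next kL.
rewrite -qE in inF1 inF2 nextE.
(* The exit point lies on a wall and, coordinatewise, between [x] and [y]. Only coordinate [i]
   changes its floor there, so the exit face is orthogonal to axis [i]. *)
have qint : int_coord q (faxis F) by apply: (int_coordP (m := _)); rewrite inF1 fcorner_int.
have qj j : j != i -> Num.floor (q j) = Num.floor (x j) /\ ~ int_coord q j.
  by move=> ji; apply: (same_floor_between _ (gx j) (gy j)) => //; rewrite l1.
have axF : faxis F = i.
  by apply/eqP/negP => /negP /qj[_]; exact.
have neqi : Num.floor (x i) <> Num.floor (y i).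
  move=> e; have [_] := same_floor_between e (gx i) (gy i) (btw i).
  by rewrite -axF.
have [bsF axs his sK] := pairing bF.
rewrite axF in inF1 inF2 out axs qint.
have [h [hE fE yi]] : exists h, [/\ fhigh F = h, f = glued M sigma i h &
     Num.floor (y i) = Num.floor (x i) + (if h then 1 else -1)].
  have uy : y i - x i = (T2 - T1) * u i by rewrite yx /pmove; ring.
  have := floor_itv (x i); have := floor_itv (y i); rewrite !intrD => fy fx.
  case: l2 => -[e ->]; first by case: neqi.
    have xy : x i < y i by move: fx fy; rewrite e intrD; lra.
    by exists true; split=> //; move: out; case: (fhigh F) => // ui; nra.
  have xy : y i < x i by move: fx fy; rewrite e intrD; lra.
  exists false; split=> //; last by rewrite e addrK.
  by move: out; case: (fhigh F) => // ui; nra.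
have xgt : (Num.floor (x i))%:~R < x i.
  by rewrite lt_neqAle ge_floor andbT; apply/eqP/gx.
have ygt : (Num.floor (y i))%:~R < y i.
  by rewrite lt_neqAle ge_floor andbT; apply/eqP/gy.
have xlt := floorD1_gt (x i); have ylt := floorD1_gt (y i).
have qi : Num.floor (q i) = Num.floor (x i) + (if h then 1 else 0).
  have b1 : Num.floor (x i) + (if h then 1 else 0) - 1 < Num.floor (q i).
    rewrite -(ltr_int R) qint; move: xgt xlt ygt ylt; rewrite yi.
    by case: h {hE fE yi} => /=; rewrite !intrD; case: (btw i); lra.
  have b2 : Num.floor (q i) < Num.floor (x i) + (if h then 1 else 0) + 1.
    rewrite -(ltr_int R) qint; move: xgt xlt ygt ylt; rewrite yi.
    by case: h {hE fE yi b1} => /=; rewrite !intrD; case: (btw i); lra.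
  by move: b1 b2; clear; lia.
(* Along axis [i] the cube behind the face is determined by the height of the wall; along the others
   the floors of [q] and [x] agree. *)
have cF : fcell F = cube_of x.
  apply/ffunP => j; rewrite ffunE; have [->|ji] := eqVneq j i.
    by move: inF1; rewrite fcorner_int axF eqxx hE /= -qint qi => /intr_inj/addIr ->.
  have [e n] := qj j ji; rewrite -e; apply/esym/floor_cell => //.
  by have := inF2 j ji; rewrite /fcorner axF (negbTE ji) addr0.
have FE : F = Face (cube_of x) i h by rewrite -cF -axF -hE; case: (F).
have fc : f (cube_of x) = fcell (sigma F).
  by rewrite fE /glued -FE ifN //; exact: bF.2.
have trE j : @Defs.ftrans R sigma F j = (fcell (sigma F) j + (if (j == i) && ~~ h then 1 else 0)
    - (fcell F j + (if (j == i) && h then 1 else 0)))%:~R.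
  by rewrite /Defs.ftrans !fcorner_int axs axF his hE intrB.
have nE : pos k.+1 T2 = padd y (@Defs.ftrans R sigma F).
  rewrite /pos nextE /y qx; apply/funext => j; rewrite /padd /pmove /x /pos /pmove; ring.
rewrite fc; split; first exact: bsF.1.
  apply/ffunP => j; rewrite ffunE nE /padd trE floor_shift cF ffunE.
  have [->|ji] /= := eqVneq j i; last by rewrite l1 //; clear; lia.
  by rewrite yi; case: (h) => /=; clear; lia.
move=> j; rewrite nextE /padd trE; have [->|ji] /= := eqVneq j i.
  by rewrite -qint qi cF ffunE -intrD; case: (h) => /=; rewrite -intrD1 !ler_int; clear; lia.
have := inF2 j ji; rewrite /fcorner axF (negbTE ji) /= !addr0 intrB; lra.
Qed.

Lemma start_nongeneric k : (k.+1 < size L)%N -> ~ generic (pmove base (start k.+1) u).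
Proof.
move=> kL /(pos_generic _ (ltnW kL)); have [F [_ [inF _] _ _ _]] := piece_next kL.
have -> : pos k (start k.+1) = pmove (piece k).1 (piece k).2 u.
  by rewrite /pos startS; congr pmove; ring.
move=> /(_ (faxis F)); apply; apply: (int_coordP (m := _)); rewrite inF fcorner_int //.
Qed.

(** Otherwise piece [k.+1] starts in the closed cube that contains its prolongation to [T2]. By
    convexity the line stays in this cube of [M] throughout, yet it must leave [M] just after the
    end of the piece. *)
Lemma no_skipped_piece k T1 T2 f : (k.+2 < size L)%N -> start k <= T1 <= start k.+1 ->
  start k.+2 <= T2 -> generic (pmove base T1 u) -> generic (pmove base T2 u) ->
  link M sigma (pmove base T1 u) (pmove base T2 u) f -> False.
Proof.
move=> kL h1 h2 g1 g2 lk; have kL' := ltnW kL.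
have s12 : start k.+1 <= start k.+2 by apply: start_le; rewrite leqnSn ltnW.
have [cM cE cB] := cross_face kL' h1 (le_trans s12 h2) g1 g2 lk.
have [_ [_ _ _ [e e0 he] _]] := piece_next kL.
have lt2 : start k.+2 < T2.
  rewrite lt_neqAle h2 andbT; apply/eqP => E; apply: (start_nongeneric kL).
  by rewrite E.
pose t := Order.min (e / 2) (T2 - start k.+2).
have t0 : 0 < t by rewrite lt_min; apply/andP; split; lra.
have [t1 t2] : t <= e / 2 /\ t <= T2 - start k.+2.
  by rewrite /t !ge_min !lexx orbT.
apply: (he t); first lra.
exists (f (cube_of (pos k T1))) => // j.
have s2 := startS k.+1; have [s0 _] := piece_in kL'.
have := between_pmove (piece k.+1).1 j (_ : 0 <= (piece k.+1).2 + t <= T2 - start k.+1).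
move=> /(_ ltac:(lra)); rewrite -/(pos k.+1 T2).
have := cB j; rewrite cE ffunE; have := floor_itv (pos k.+1 T2 j); rewrite intrD.
by move=> b1 b2 [] b3; lra.
Qed.

(** For [T1 <= T2], the pieces are equal or consecutive: skipping a piece is impossible, and a
    decreasing index would put both times at a junction, which is not generic. *)
Lemma track_link T1 T2 k1 k2 f : on_piece k1 T1 -> on_piece k2 T2 ->
  generic (pmove base T1 u) -> generic (pmove base T2 u) ->
  link M sigma (pmove base T1 u) (pmove base T2 u) f ->
  f (cube_of (pos k1 T1)) = cube_of (pos k2 T2).
Proof.
wlog T12 : T1 T2 k1 k2 f / T1 <= T2.
  move=> W o1 o2 g1 g2 lk; have [T12|/ltW T21] := lerP T1 T2; first exact: W.
  have [g lg gK] := link_sym lk.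
  by rewrite -(W _ _ _ _ _ T21 o2 o1 g2 g1 lg) gK //; exact: cube_of_pos.
move=> o1 o2 g1 g2 lk; case: (o1) => [k1L h1]; case: (o2) => [k2L h2].
have [kk|kk|kk] := ltngtP k1 k2.
- move: kk; rewrite leq_eqVlt => /orP[/eqP kE|kk].
    have k2L' := k2L; rewrite -kE in k2L' h2 *.
    by have [] := cross_face k2L' h1 (andP h2).1 g1 g2 lk.
  have le2 : start k1.+2 <= start k2 by apply: start_le; rewrite kk ltnW.
  exfalso; apply: (no_skipped_piece (leq_ltn_trans kk k2L) h1 _ g1 g2 lk); lra.
- have le1 : start k2.+1 <= start k1 by apply: start_le; rewrite kk ltnW.
  case: k1 kk k1L h1 le1 o1 => // k kk k1L h1 le1 o1; exfalso.
  by apply: (start_nongeneric k1L); have -> : start k.+1 = T1 by lra.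
- rewrite -kk in o2 h2 *; apply: link_cube_of; first exact: cube_of_pos.
  by have [m hm] := pos_shift k1L; rewrite !hm; exact: link_shift.
Qed.

(** The bounds on [n] keep the two-sided window inside the segment, where the abstract transport of
    sheets gives the cube actually occupied. *)
Lemma track_itin n T0 k0 t f : on_piece k0 T0 -> generic (pmove base T0 u) ->
  0 <= n <= T0 -> T0 + n <= seg_length L ->
  itin M sigma u n (pmove base T0 u) t f ->
  exists2 k, on_piece k (T0 + t) & f (cube_of (pos k0 T0)) = cube_of (pos k (T0 + t)).
Proof.
move=> o0 g0 n0 nL it.
have : (exists2 k, on_piece k (T0 + t) & f (cube_of (pos k0 T0)) = cube_of (pos k (T0 + t)))
   /\ generic (pmove base (T0 + t) u).
  elim: it => [|{}t {}f t' g _ [[k ok E] gt] t'n gt' lk].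
    by rewrite addr0; split=> //; exists k0.
  rewrite !pmoveD in gt' lk; split=> //.
  have [k' ok'] : exists k, on_piece k (T0 + t').
    by apply: on_piece_exists; move: t'n; rewrite ler_norml; lra.
  by exists k' => //=; rewrite E; exact: (track_link ok ok' gt gt' lk).
by case.
Qed.

End Geodesic.
(** * Visiting frequency *)

Lemma lebesgue_measure_ge_interval (R : realType) (V : set R) (a d : R) : 0 < d ->
  (forall t, a <= t <= a + d -> V t) -> (d%:E <= lebesgue_measure V)%E.
Proof.
move=> d0 h; have <- : lebesgue_measure `[a, a + d]%classic = d%:E.
  by rewrite lebesgue_measure_itv /= lte_fin ltrDl d0 -EFinD addrAC subrr add0r.
by apply: le_mu_ext => t /=; rewrite in_itv /=; exact: h.
Qed.

Lemma visit_measure_ge (R : realType) (G : set (pt R)) (v : pt R) (L : seq (pt R * R))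
    (d : R) (N : nat) (f : 'I_N -> nat) : injective f -> (forall j, (f j < size L)%N) ->
  (forall j, (d%:E <= lebesgue_measure (visit_set G v (piece L (f j))))%E) ->
  ((N%:R * d)%:E <= visit_measure G v L)%E.
Proof.
move=> f_inj fL hd; pose g j : 'I_(size L) := Ordinal (fL j).
have g_inj : injective g by move=> i j [/f_inj].
rewrite /visit_measure (big_nth ((fun _ => 0) : pt R, 0)) big_mkord.
have -> : (N%:R * d)%:E = (\sum_(k < size L) if k \in codom g then d%:E else 0)%E.
  by rewrite -big_mkcond sumEFin sumr_const card_codom // card_ord mulr_natl.
apply: lee_sum => k _; case: ifP => [/codomP[j ->]|_]; first exact: hd.
exact: measure_ge0.
Qed.

(** The given point may lie on the boundary of its cube, so the box is centred further inside. Its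
    double still lies in [G], leaving room to move during a visit. *)
Lemma open_box (R : realType) M sigma (G : set (pt R)) x : manifold_open M sigma G -> G x ->
  exists (c0 : cell) (f0 : pt R) (e0 : R), [/\ c0 \in M, 0 < e0,
    forall j, e0 < f0 j < 1 - e0 &
    forall y, (forall j, `|y j - ((c0 j)%:~R + f0 j)| < 2 * e0) -> G y /\ generic y].
Proof.
move=> [GM Go _] Gx; have [c cM hc] := GM x Gx; have [e e1 he] := Go x Gx.
pose th := Order.min e 1.
have th0 : 0 < th by rewrite lt_min e1 ltr01.
have [the th1] : th <= e /\ th <= 1 by rewrite /th !ge_min !lexx orbT.
(* Moving the fraction [th / 2] of the way to the centre of the cube displaces each coordinate by at
   most [th / 4] and leaves at least [th / 4], twice the chosen radius, to every wall. *)
exists c, (fun j => x j - (c j)%:~R + th / 2 * ((c j)%:~R + 1 / 2 - x j)), (th / 8).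
split=> // [|j|y hy]; first lra.
  by have := hc j; move: (x j) (c j)%:~R => a b hab; nra.
have hy' j : (c j)%:~R < y j < (c j)%:~R + 1 /\ `|y j - x j| < th.
  have := hc j; have := hy j; rewrite !ltr_norml.
  by move: (x j) (y j) (c j)%:~R => a y' b h1 h2; split; nra.
split=> [|j].
  apply: he => [|j]; last by apply: lt_le_trans the; have [] := hy' j.
  by exists c => // j; have [h _] := hy' j; lra.
have [h _] := hy' j; rewrite /int_coord.
have -> : Num.floor (y j) = c j by apply: floor_def; rewrite intrD; lra.
lra.
Qed.

(** A piece stays in the bounded set [M] while its coordinate [j] moves at the nonzero speed
    [u j]. *)
Lemma piece_length_bound (R : realType) (M : seq cell) (u : pt R) (j : 'I_3) : u j != 0 ->
  exists2 D : R, 0 <= D & forall sigma (L : seq (pt R * R)) k, chain_ok M sigma u L ->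
    (k < size L)%N -> (piece L k).2 <= D.
Proof.
move=> uj; have [] := @seq_uniform_bound _ M (fun (c : cell) n => (`|c j| <= n)%N).
- by move=> c m n mn /leq_trans; exact.
- by move=> c _; exists `|c j|%N.
move=> B hB; have uj' : 0 < `|u j| by rewrite normr_gt0.
exists ((2 * B%:R + 2) / `|u j|); first by rewrite divr_ge0 // addr_ge0 // mulr_ge0.
move=> sigma L k ok kL; have [s0 hs] := piece_in ok kL.
have bnd (x : pt R) : inM M x -> - B%:R - 1 <= x j <= B%:R + 1.
  move=> [c cM /(_ j)]; have : `|(c j)%:~R| <= B%:R :> R.
    by rewrite -intr_norm -[leRHS]/((B%:Z)%:~R) ler_int -abszE lez_nat; exact: hB.
  by rewrite ler_norml; lra.
have b0 := bnd _ (hs 0 (introT andP (conj (lexx _) s0))).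
have b1 := bnd _ (hs _ (introT andP (conj s0 (lexx _)))).
rewrite ler_pdivlMr // -[X in X * _](ger0_norm s0) -normrM ler_norml.
by move: b0 b1; rewrite /pmove mul0r addr0; lra.
Qed.

(** * The unit vector of a Kronecker direction *)

Section Kronecker_direction.
Variables (R : realType) (a1 a2 : R).
Hypothesis kro : kronecker a1 a2.

Let u : pt R := unitdir (dirv a1 a2).
Let speed : R := Num.sqrt (a1 ^+ 2 + a2 ^+ 2 + 1 ^+ 2).

Lemma speed_gt0 : 0 < speed.
Proof. by rewrite sqrtr_gt0 expr1n ltr_wpDl // addr_ge0 // sqr_ge0. Qed.

Lemma unitdirE j : u j = dirv a1 a2 j / speed.
Proof. by rewrite /u /unitdir. Qed.

Lemma unitdir_indep i j : i != j -> forall m n : int,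
  m%:~R * u i = n%:~R * u j -> m = 0 /\ n = 0.
Proof.
move=> ij m n; rewrite !unitdirE !mulrA => /(divIf (lt0r_neq0 speed_gt0)) {}h.
have K p q r := kronecker_int kro (p := p) (q := q) (r := r).
move: ij h; rewrite /dirv.
case: (ord3P i) => ->; case: (ord3P j) => -> //= _ h.
- by have [|-> /eqP] := K m (- n) 0; [rewrite mulrNz; lra|rewrite oppr_eq0 => /eqP].
- by have [|-> _ /eqP] := K m 0 (- n); [rewrite mulrNz; lra|rewrite oppr_eq0 => /eqP].
- by have [|/eqP + ->] := K (- n) m 0; [rewrite mulrNz; lra|rewrite oppr_eq0 => /eqP].
- by have [|_ -> /eqP] := K 0 m (- n); [rewrite mulrNz; lra|rewrite oppr_eq0 => /eqP].
- by have [|/eqP + _ ->] := K (- n) 0 m; [rewrite mulrNz; lra|rewrite oppr_eq0 => /eqP].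
- by have [|_ /eqP + ->] := K 0 (- n) m; [rewrite mulrNz; lra|rewrite oppr_eq0 => /eqP].
Qed.

Lemma unitdir_dense (e : R) : 0 < e -> exists2 T : R, 0 <= T &
  forall z y : pt R, exists t (m : 'I_3 -> int), 0 <= t <= T /\
    eclose e y (pshift m (pmove z t u)).
Proof.
move=> e0; have [T T0 hT] := torus_line_uniform kro speed_gt0 e0.
by exists T.
Qed.

End Kronecker_direction.

(** * Visits within bounded length *)

Section Visits.
Variables (R : realType) (M : seq cell) (sigma : face -> face) (u : pt R).
Hypothesis region : polycube_region M.
Hypothesis pairing : face_pairing M sigma.
Hypothesis u_indep : forall i j, i != j -> forall m n : int,
  m%:~R * u i = n%:~R * u j -> m = 0 /\ n = 0.
Hypothesis u_dense : forall e : R, 0 < e -> exists2 T : R, 0 <= T &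
  forall z y : pt R, exists t (m : 'I_3 -> int), 0 <= t <= T /\
    eclose e y (pshift m (pmove z t u)).
Variables (c0 : cell) (f0 : pt R) (e0 : R).
Hypothesis c0M : c0 \in M.
Hypothesis e0_gt0 : 0 < e0.
Hypothesis box_in : forall j, e0 < f0 j < 1 - e0.

Lemma uniform_visit : exists n : nat, forall z c, generic z -> c \in M ->
  (forall t, `|t| <= n%:R -> ~ singular (pmove z t u)) ->
  exists t f, itin M sigma u n%:R z t f /\ in_box c0 f0 e0 (pmove z t u) (f c).
Proof.
apply: contrapT => /forallNP h.
apply: (not_evading region pairing u_indep u_dense c0M e0_gt0 box_in) => n.
have /existsNP[z /existsNP[c h']] := h n.
exists z, c; apply: contrapT => h''; apply: h' => gz cM ns.
apply: contrapT => none; apply: h''; split=> // t f hf hb.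
by apply: none; exists t, f.
Qed.

(** Pigeonhole: four disjoint blocks, three directions of edges, and at most one edge of each
    direction on the line. *)
Lemma nonsingular_block z a A : 0 <= A -> exists i : 'I_4, forall T,
  a + i%:R * (A + 1) <= T <= a + i%:R * (A + 1) + A -> ~ singular (pmove z T u).
Proof.
move=> A0; apply: contrapT => /forallNP h.
have /choice[g hg] (i : 'I_4) : exists l : 'I_3, exists2 T,
    a + i%:R * (A + 1) <= T <= a + i%:R * (A + 1) + A &
    forall j, j != l -> int_coord (pmove z T u) j.
  have /existsNP[T /not_implyP[hT /contrapT[p [q [pq hp hq]]]]] := h i.
  have [l [lp lq]] : exists l : 'I_3, l != p /\ l != q.
    move: pq; case: (ord3P p) => ->; case: (ord3P q) => -> // _;
      solve [by exists 0 | by exists 1 | by exists 2].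
  exists l, T => // j jl; have [->//|->//|E] := ord3_third j pq lp lq.
  by rewrite E eqxx in jl.
have /injectivePn [i [i' ii' E]] : ~~ injectiveb g.
  by apply/negP => /injectiveP /leq_card; rewrite !card_ord.
have [T hT tT] := hg i; have [T' hT' tT'] := hg i'; rewrite -E in tT'.
have [p [q [pq pl ql]]] : exists p q, [/\ p != q, p != g i & q != g i].
  by case: (ord3P (g i)) => ->; [exists 1, 2|exists 0, 2|exists 0, 1].
have TT := singular_time_unique u_indep pq (tT p pl) (tT q ql) (tT' p pl) (tT' q ql).
wlog lt : i i' ii' E T T' hT hT' tT tT' TT pl ql / (i < i')%N.
  move=> W; have := ii'; rewrite -val_eqE neq_ltn => /orP[lt|lt].
    exact: (W i i' ii' E T T').
  by apply: (W i' i _ (esym E) T' T) => //; rewrite -?E // eq_sym.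
have : i%:R + 1 <= i'%:R :> R by rewrite natr1 ler_nat.
rewrite -TT in hT'; nra.
Qed.

Lemma itin_time n z t f : 0 <= n -> itin M sigma u n z t f -> `|t| <= n.
Proof. by move=> n0; case=> //; rewrite normr0. Qed.

Lemma geodesic_visit : exists2 W : R, 0 < W & forall L, chain_ok M sigma u L -> L != [::] ->
  forall a, 0 <= a -> a + W <= seg_length L -> exists k T,
  [/\ on_piece L k T, a <= T, T + 1 <= a + W &
    forall j, `|pos u L k T j - ((c0 j)%:~R + f0 j)| < e0].
Proof.
have [n hn] := uniform_visit.
(* A block must hold the window of radius [n] around [T0], the offset [h <= 1 / 2] making [T0]
   generic, and one more unit of length after the visit. *)
have n0 := ler0n R n; pose A : R := 2 * n%:R + 2; have AE : A = 2 * n%:R + 2 by [].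
have A0 : 0 <= A by lra.
exists (4 * (A + 1)) => [|L ok L0 a a0 aL]; first lra.
pose z := base L.
have [i hi] := nonsingular_block z a A0; set b := a + _ in hi.
have i3 : i%:R <= 3 :> R by rewrite ler_nat -ltnS.
have ba : a <= b by rewrite /b lerDl mulr_ge0 //; lra.
have bA : b + A + 1 <= a + 4 * (A + 1) by rewrite /b; nra.
have [d d0 hd] := punctured_generic z (b + n%:R) (dir_neq0 u_indep).
pose h := Order.min (d / 2) (1 / 2).
have h0 : 0 < h by rewrite lt_min; apply/andP; split; lra.
have [hd2 h12] : h <= d / 2 /\ h <= 1 / 2 by rewrite /h !ge_min !lexx orbT.
pose T0 := b + n%:R + h.
have gT0 : generic (pmove z T0 u).
  by apply: hd; rewrite /T0 addrC addKr gtr0_norm //; lra.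
have [k0 ok0] : exists k, on_piece L k T0.
  by apply: (on_piece_exists L0); rewrite /T0; lra.
have [|t [f [it [fc hf]]]] := hn _ _ gT0 (cube_of_pos ok ok0 gT0).
  move=> t; rewrite ler_norml pmoveD => ht; apply: hi.
  by rewrite /T0; lra.
have tn := itin_time n0 it; rewrite ler_norml in tn.
have [||k okk E] := track_itin pairing ok L0 ok0 gT0 _ _ it.
- by rewrite /T0; lra.
- by rewrite /T0; lra.
exists k, (T0 + t); split=> //; [by rewrite /T0; lra|by rewrite /T0; lra|].
move=> j; rewrite fc in E; rewrite E ffunE.
have [m hm] := pos_shift ok okk.1; rewrite hm.
have := hf j; rewrite pmoveD /fpart /pshift floor_shift intrD -/z.
by rewrite !ltr_norml; lra.
Qed.

End Visits.

Theorem theorem4 (R : realType) (M : seq cell) (sigma : face -> face)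
    (a1 a2 : R) :
  polycube_region M -> face_pairing M sigma -> kronecker a1 a2 ->
  forall G : set (pt R), manifold_open M sigma G -> (exists x, G x) ->
  exists Fr c : R, [/\ 0 < Fr, 0 < c &
    forall L : seq (pt R * R), geodesic_segment M sigma (dirv a1 a2) L ->
      c <= seg_length L ->
      ((Fr * seg_length L)%:E <= visit_measure G (dirv a1 a2) L)%E].
Proof.
move=> region pairing kro G Gopen [x Gx].
have [c0 [f0 [e0 [c0M e0_gt0 box_in boxG]]]] := open_box Gopen Gx.
set u := unitdir (dirv a1 a2).
have u_indep := unitdir_indep kro; have u_dense := unitdir_dense kro.
have [W W0 hW] := geodesic_visit region pairing u_indep u_dense c0M e0_gt0 box_in.
have [D D0 hD] := piece_length_bound M (dir_neq0 u_indep 2).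
have [d1 d10 hd1] := pmove_near u e0_gt0.
pose d := Order.min (d1 / 2) 1.
have d0 : 0 < d by rewrite lt_min ltr01 andbT; lra.
have [dd1 d1'] : d <= d1 / 2 /\ d <= 1 by rewrite /d !ge_min !lexx orbT.
(* Windows at spacing [P] put successive visits more than [D] apart, hence on different pieces,
   whose measures add up. *)
pose P := W + D + 1; have P0 : 0 < P by rewrite /P; lra.
(* Each of the [N] windows contributes [d], and [N * P > l - P >= l / 2] as soon as [l >= 2 * P]. *)
exists (d / (2 * P)), (2 * P); split; [by rewrite divr_gt0 // mulr_gt0|by rewrite mulr_gt0|].
move=> L [L0 ok] lL; set l := seg_length L in lL *.
have lP0 : 0 <= l / P by rewrite divr_ge0 //; lra.
pose N := Num.trunc (l / P).
have /andP[N1 N2] := truncn_itv lP0; rewrite -/N ler_pdivlMr // in N1.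
rewrite -/N ltr_pdivrMr // -natr1 in N2.
have /choice[g hg] (j : 'I_N) : exists kT : nat * R,
  [/\ on_piece L kT.1 kT.2, j%:R * P <= kT.2, kT.2 + 1 <= j%:R * P + W &
    forall i, `|pos u L kT.1 kT.2 i - ((c0 i)%:~R + f0 i)| < e0].
  have jN : j%:R + 1 <= N%:R :> R by rewrite natr1 ler_nat.
  have [||k [T [h1 h2 h3 h4]]] := hW L ok L0 (j%:R * P); last by exists (k, T).
  - by rewrite mulr_ge0 // ltW.
  - have WP : W <= P by rewrite /P; lra.
    by rewrite -/l; nra.
have g_inj : injective (fun j => (g j).1).
  move=> i j /= E; apply: val_inj => /=.
  wlog lt : i j E / (i < j)%N.
    move=> W'; have [lt|lt|//] := ltngtP i j; first exact: W'.
    by apply/esym/W'.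
  have [[kL o1] _ h1 _] := hg i; have [[_ o2] h2 _ _] := hg j.
  have ij : i%:R + 1 <= j%:R :> R by rewrite natr1 ler_nat.
  have := hD _ _ _ ok kL; rewrite -E in o2; move: o1 o2; rewrite startS.
  have PE : P = W + D + 1 by [].
  have : (i%:R + 1) * P <= j%:R * P by rewrite ler_pM2r.
  by move=> *; exfalso; lra.
apply: le_trans (visit_measure_ge (f := fun j => (g j).1) (d := d) g_inj _ _).
- rewrite lee_fin mulrAC ler_pdivrMr ?mulr_gt0 //; nra.
- by move=> j; have [[]] := hg j.
move=> j; have [[kL oT] _ h1 h2] := hg j; move: (g j).1 (g j).2 kL oT h1 h2 => k T kL oT h1 h2.
have jN : j%:R + 1 <= N%:R :> R by rewrite natr1 ler_nat.
have inG t : 0 <= t <= d -> G (pos u L k (T + t)) /\ generic (pos u L k (T + t)).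
  move=> ht; apply: boxG => i.
  have -> : pos u L k (T + t) = pmove (pos u L k T) t u.
    by rewrite /pos pmoveD; congr pmove; ring.
  have := h2 i; have := hd1 (pos u L k T) 0 t; rewrite pmove0 subr0.
  have tl : `|t| < d1 by rewrite ger0_norm; lra.
  by move=> /(_ tl i); rewrite !ltr_norml; lra.
have Tl : T + 1 <= l.
  have WP : W <= P by rewrite /P; lra.
  nra.
(* A piece cannot end during the visit: a junction lies on a wall while the enlarged box consists of
   generic points, and the last piece ends too late because [T + 1 <= l]. *)
have end_ok : T + d <= start L k.+1.
  rewrite leNgt; apply/negP => lt.
  move: kL; rewrite leq_eqVlt => /orP[/eqP E|kL].
    by move: lt; rewrite E start_size -/l; lra.
  have [_] := inG (start L k.+1 - T) ltac:(lra).
  rewrite addrC subrK => /(pos_generic ok _ (ltnW kL)).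
  exact: start_nongeneric ok _ kL.
apply: (lebesgue_measure_ge_interval (a := T - start L k)) => // t ht.
split; first by move: end_ok; rewrite startS; lra.
have [] := inG (t - (T - start L k)) ltac:(lra).
by rewrite /pos; have -> : T + (t - (T - start L k)) - start L k = t by ring.
Qed.
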